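(* Let $(U_N^k)_{0\le k\le N_t}$ be the velocity component of the fully discrete Fourier--Galerkin splitting Runge--Kutta method described in the context, with $G_N=P_N\Lambda\Phi$, and assume that the Runge--Kutta coefficients satisfy the symplectic condition $$b_ia_{ij}+b_ja_{ji}=b_ib_j\quad(i,j=1,\dots,s),\qquad \sum_{i=1}^sb_i=1.$$ Then $$\mathbb E\|U_N^k\|_{H^1}^2=\mathbb E\|U_N^0\|_{H^1}^2+t_k\,\|G_N\|_{\mathcal L_2(\mathcal U;H^1)}^2,\qquad k=0,1,\dots,N_t.$$
   Context: $\mathbb T_L=\mathbb R/L\mathbb Z$ is identified with $[a,b)$, $L=b-a$, $\mu=2\pi/L$. Fourier coefficients: $\widehat f(k)=\frac1L\int_a^bf(x)e^{-\mathrm ik\mu(x-a)}dx$; $\|f\|_{H^r}^2=\sum_k(1+|k\mu|^2)^r|\widehat f(k)|^2$; $H_0^r$ is the zero-mean subspace of $H^r(\mathbb T_L)$. $\Lambda=(1-\partial_x^2)^{-1}$. $W$ is a cylindrical Wiener process on $\mathcal U=L^2_0(\mathbb T_L)$ (zero-mean $L^2$), adapted to a filtration $(\mathcal F_t)$; $\mathcal L_2$ denotes Hilbert--Schmidt operators; $u_0\in H_0^\sigma(\mathbb T_L)$ is deterministic and $\Phi\in\mathcal L_2(\mathcal U;H_0^{\sigma-2}(\mathbb T_L))$ with $\sigma>5/2$. For $N\ge1$, $S_N$ is the space of real-valued zero-mean trigonometric polynomials $\sum_{0<|k|\le N}\widehat v(k)e^{\mathrm ik\mu(x-a)}$, and $P_Nf=\sum_{0<|k|\le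 N}\widehat f(k)e^{\mathrm ik\mu(x-a)}$. Time grid: $\tau=T/N_t$, $t_k=k\tau$; $\Delta W_k=W(t_{k+1})-W(t_k)$. Method (velocity component): let $\mathbf A=(a_{ij})_{i,j=1}^s$ be an invertible real matrix and $b\in\mathbb R^s$ (coefficients of an $s$-stage Runge--Kutta method). Set $U_N^0=P_Nu_0$ and $F_N(U)=-P_N\bigl[\frac12\partial_x(U^2)+\partial_x\Lambda(U^2+\frac12(\partial_xU)^2)\bigr]$. Given $U_N^k\in S_N$, $$U_{N,i}^k=U_N^k+\tau\sum_{j=1}^sa_{ij}F_N(U_{N,j}^k)\ (i=1,\dots,s),\qquad \bar U_N^{k+1}=U_N^k+\tau\sum_{i=1}^sb_iF_N(U_{N,i}^k),$$ $$U_N^{k+1}=\bar U_N^{k+1}+G_N\Delta W_k.$$ It is assumed that $\tau$ is small enough that the stage equations have a locally unique solution $(U_{N,i}^k)_i\in S_N^s$ near $(U_N^k,\dots,U_N^k)$ (this is the solution used), and the stage values are $\mathcal F_{t_k}$-measurable. *)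

(* Defs.v *)
From HB Require Import structures.
From mathcomp Require Import all_boot all_order all_algebra.
From mathcomp Require Import complex.
From mathcomp Require Import all_classical all_reals all_analysis.

Set Implicit Arguments.
Unset Strict Implicit.
Unset Printing Implicit Defensive.

Import Order.TTheory GRing.Theory Num.Theory.
Import numFieldNormedType.Exports.

Local Open Scope classical_set_scope.
Local Open Scope complex_scope.
Local Open Scope ring_scope.

(** A function on the torus R/(b-a)Z is given by a representative [R -> R], of
    which only the values on [a, b[ matter; elements of L^2 and H^r are such
    representatives, and equalities between them hold almost everywhere. *)
Section FourierSobolev.
Context {R : realType} (a b : R).
Implicit Types (f g : R -> R) (k : int) (r x : R).

Definition torus : set R := `[a, b[.

Definition len : R := b - a.

Definition freq : R := 2 * pi / len.

Definition cis (theta : R) : R[i] := cos theta +i* sin theta.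

Definition mode k x : R[i] := cis (k%:~R * freq * (x - a)).

Definition cintegral (F : R -> R[i]) : R[i] :=
  (\int[lebesgue_measure]_(x in torus) complex.Re (F x))
  +i* (\int[lebesgue_measure]_(x in torus) complex.Im (F x)).

Definition fhat f k : R[i] :=
  (len^-1)%:C * cintegral (fun x => (f x)%:C * mode (- k) x).

Definition csqnorm (z : R[i]) : R := complex.Re z ^+ 2 + complex.Im z ^+ 2.

Definition Hnorm2 r f : \bar R :=
  \esum_(k in [set: int])
    ((1 + `|k%:~R * freq| ^+ 2) `^ r * csqnorm (fhat f k))%:E.

Definition L2 f : Prop :=
  measurable_fun torus f /\
  (@lebesgue_measure R).-integrable torus (EFin \o (fun x => f x ^+ 2)).

(* Meant for 0 <= r, where H^r is a subspace of L^2. *)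
Definition H0 r f : Prop :=
  [/\ L2 f, fhat f 0 = 0 & (Hnorm2 r f < +oo)%E].

Definition L20 f : Prop := L2 f /\ fhat f 0 = 0.

(* The inner product is normalised by 1/L, so that the norm of L^2_0 is the
   H^0 norm above (Parseval). *)
Definition inner f g : R :=
  len^-1 * \int[lebesgue_measure]_(x in torus) (f x * g x).

Definition trig_sum (N : nat) (c : int -> R[i]) x : R[i] :=
  \sum_(1 <= n < N.+1) (c n%:Z * mode n%:Z x + c (- n%:Z) * mode (- n%:Z) x).

(* The space S_N: a real-valued function equal to such a sum. *)
Definition SN (N : nat) f : Prop :=
  exists c : int -> R[i], forall x, (f x)%:C = trig_sum N c x.

(* For real-valued [f] the sum is real: taking [Re] only changes the type. *)
Definition PN (N : nat) f : R -> R :=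
  fun x => complex.Re (trig_sum N (fhat f) x).

(* (1 - d^2/dx^2)^{-1}, i.e. the Fourier multiplier 1 / (1 + (k freq)^2); the
   series converges absolutely for f in L^2. *)
Definition Lam f : R -> R := fun x =>
  let c k := ((1 + (k%:~R * freq) ^+ 2)^-1)%:C * fhat f k in
  lim ((fun n => complex.Re (c 0 + trig_sum n c x)) @ \oo).

(* [derive1] is the ordinary derivative; it is applied below to trigonometric
   polynomials only. *)
Definition FN (N : nat) (U : R -> R) : R -> R :=
  let Ux := derive1 U in
  fun x => - PN N (fun y =>
      2^-1 * derive1 (fun z => U z ^+ 2) y
      + derive1 (Lam (fun z => U z ^+ 2 + 2^-1 * Ux z ^+ 2)) y) x.

Definition is_onb (e : nat -> R -> R) : Prop :=
  [/\ forall j, L20 (e j),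
      forall i j, inner (e i) (e j) = (i == j)%:R
    & forall f, L20 f ->
        (fun n => let g x := f x - \sum_(j < n) inner f (e j) * e j x in
                  inner g g) @ \oo --> (0 : R)].

Definition hs_norm2 (e : nat -> R -> R) r (G : (R -> R) -> R -> R) : \bar R :=
  (\sum_(0 <= j <oo) Hnorm2 r (G (e j)))%E.

(* Linearity holds almost everywhere, and boundedness makes [Phi] well defined
   on almost-everywhere classes. *)
Record hilbert_schmidt (e : nat -> R -> R) r (Phi : (R -> R) -> R -> R) : Prop := {
  hs_codom : forall f, L20 f -> H0 r (Phi f);
  hs_linear : forall (c : R) f g, L20 f -> L20 g ->
    ae_eq lebesgue_measure torus
      (Phi (fun x => c * f x + g x)) (fun x => c * Phi f x + Phi g x);
  hs_bounded : exists C : R, forall f, L20 f ->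
    (Hnorm2 r (Phi f) <= (C * inner f f)%:E)%E;
  hs_summable : (hs_norm2 e r Phi < +oo)%E }.

End FourierSobolev.

Section Wiener.
Context {R : realType} (a b : R) {d : measure_display} {Omega : measurableType d}
  (P : probability Omega R).

Definition filtration (T : R) (F : R -> set (set Omega)) : Prop :=
  (forall t, 0 <= t <= T ->
     sigma_algebra [set: Omega] (F t) /\ F t `<=` measurable) /\
  (forall s t, 0 <= s -> s <= t -> t <= T -> F s `<=` F t).

Definition measurable_wrt (Fs : set (set Omega)) (X : Omega -> R) : Prop :=
  forall B : set R, measurable B -> Fs (X @^-1` B).

Definition indep_of (Fs : set (set Omega)) (X : Omega -> R) : Prop :=
  forall (A : set Omega) (B : set R), Fs A -> measurable B ->
    P (A `&` X @^-1` B) = (P A * P (X @^-1` B))%E.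

(* The library's [normal_prob 0 0] is not the Dirac mass at 0. *)
Definition centered_gaussian (X : Omega -> R) (v : R) : Prop :=
  if v == 0 then {ae P, forall w, X w = 0}
  else forall B : set R, measurable B ->
         P (X @^-1` B) = normal_prob 0 (Num.sqrt v) B.

(* [W t h] is the real random variable <W(t), h>: for each h in L^2_0 it is an
   F-Brownian motion of variance ||h||^2 t, linearly in h. *)
Record cylindrical_wiener (T : R) (F : R -> set (set Omega))
    (W : R -> (R -> R) -> Omega -> R) : Prop := {
  cw_adapted : forall t h, 0 <= t <= T -> L20 a b h ->
    measurable_wrt (F t) (W t h);
  cw_zero : forall h, L20 a b h -> {ae P, forall w, W 0 h w = 0};
  cw_linear : forall t (c : R) f g, 0 <= t <= T -> L20 a b f -> L20 a b g ->
    {ae P, forall w, W t (fun x => c * f x + g x) w = c * W t f w + W t g w};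
  cw_gaussian : forall s t h, 0 <= s -> s <= t -> t <= T -> L20 a b h ->
    centered_gaussian (fun w => W t h w - W s h w) ((t - s) * inner a b h h);
  cw_indep : forall s t h, 0 <= s -> s <= t -> t <= T -> L20 a b h ->
    indep_of (F s) (fun w => W t h w - W s h w);
  cw_continuous : forall h, L20 a b h ->
    {ae P, forall w, {within `[0, T], continuous (fun t => W t h w)}} }.

(* Measurability of a random element of the finite-dimensional space S_N; the
   Fourier coefficients are linear coordinates on it. *)
Definition coef_measurable (Fs : set (set Omega)) (X : Omega -> R -> R) : Prop :=
  forall k : int,
    measurable_wrt Fs (fun w => complex.Re (fhat a b (X w) k)) /\
    measurable_wrt Fs (fun w => complex.Im (fhat a b (X w) k)).

(* X = G (W(t) - W(s)), i.e. X is the S_N-valued random variable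
   sum_j <W(t) - W(s), e_j> G e_j, the series converging in L^2(Omega; H^1). *)
Definition wiener_image (N : nat) (e : nat -> R -> R) (G : (R -> R) -> R -> R)
    (W : R -> (R -> R) -> Omega -> R) (s t : R) (X : Omega -> R -> R) : Prop :=
  [/\ forall w, SN a b N (X w),
      coef_measurable measurable X
    & (fun n : nat => (\int[P]_w Hnorm2 a b 1%R (fun x =>
          X w x - \sum_(j < n) (W t (e j) w - W s (e j) w) * G (e j) x)%R)%E)
        @ \oo --> (0 : \bar R)%E].

End Wiener.

Section Method.
Context {R : realType} (a b : R).

Definition stage_system (N s : nat) (A : 'M[R]_s) (tau : R) (U : R -> R)
    (V : 'I_s -> R -> R) : Prop :=
  forall i x, V i x = U x + tau * \sum_(j < s) A i j * FN a b N (V j) x.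

(* [V] is in S_N^s, solves the stage system, and is its only solution in some
   ball around (U, ..., U). *)
Definition locally_unique_stages (N s : nat) (A : 'M[R]_s) (tau : R)
    (U : R -> R) (V : 'I_s -> R -> R) : Prop :=
  let near (delta : R) (V' : 'I_s -> R -> R) := forall i,
    (Hnorm2 a b 1%R (fun x => V' i x - U x)%R < (delta ^+ 2)%:E)%E in
  [/\ forall i, SN a b N (V i),
      stage_system N A tau U V
    & exists2 delta : R, 0 < delta &
        near delta V /\
        forall V', (forall i, SN a b N (V' i)) -> near delta V' ->
          stage_system N A tau U V' -> V' = V].

Definition time (T : R) (Nt k : nat) : R := k%:R * (T / Nt%:R).

(* [U k w], [V k i w] and [dGW k w] are the samples of U_N^k, of the stage
   U_{N,i}^k and of G_N (W(t_{k+1}) - W(t_k)). *)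
Record splitting_RK {d : measure_display} {Omega : measurableType d}
    (P : probability Omega R) (T : R) (Nt : nat) (F : R -> set (set Omega))
    (W : R -> (R -> R) -> Omega -> R) (e : nat -> R -> R) (N : nat)
    (G : (R -> R) -> R -> R) (s : nat) (A : 'M[R]_s) (bw : 'rV[R]_s)
    (u0 : R -> R) (U : nat -> Omega -> R -> R)
    (V : nat -> 'I_s -> Omega -> R -> R) (dGW : nat -> Omega -> R -> R) : Prop := {
  rk_init : forall w, U 0%N w = PN a b N u0;
  rk_stages : forall k w, (k < Nt)%N ->
    locally_unique_stages N A (T / Nt%:R) (U k w) (fun i => V k i w);
  rk_measurable : forall k i, (k < Nt)%N ->
    coef_measurable a b (F (time T Nt k)) (V k i);
  rk_noise : forall k, (k < Nt)%N ->
    wiener_image a b P N e G W (time T Nt k) (time T Nt k.+1) (dGW k);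
  rk_step : forall k w x, (k < Nt)%N ->
    U k.+1 w x =
      (U k w x + T / Nt%:R * \sum_(i < s) bw ord0 i * FN a b N (V k i w) x)
      + dGW k w x }.

End Method.

(* Main.v *)
Require Import Defs.
From HB Require Import structures.
From mathcomp Require Import all_boot all_order all_algebra.
From mathcomp Require Import complex.
From mathcomp Require Import all_classical all_reals all_analysis.
From mathcomp Require Import measurable_realfun.
From mathcomp Require Import ring lra zify.

(** Conservation: for [w := Lambda (V^2 + V_x^2 / 2)] the product of the unprojected vector
    field [V V_x + w_x] with [V - V_xx] is an exact derivative, so [F_N V] is [H^1]-orthogonal
    to [V]; a symplectic Runge-Kutta method preserves every quadratic invariant, hence each
    deterministic substep preserves the [H^1] norm pathwise. Noise: the substep is measurable
    with respect to the sigma-algebra at time [t_k] while the coordinates of the Wiener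
    increment are centered, pairwise uncorrelated, of variance [tau], and independent of it, so
    adding [G_N Delta W_k] adds [tau] times the squared Hilbert-Schmidt norm to the mean
    squared norm. Everything is finite-dimensional: on [S_N] the [H^1] norm is a weighted sum
    of squares of Fourier coordinates. *)

Set Implicit Arguments.
Unset Strict Implicit.
Unset Printing Implicit Defensive.

Import Order.TTheory GRing.Theory Num.Theory.
Import numFieldNormedType.Exports.

Local Open Scope classical_set_scope.
Local Open Scope ring_scope.

(** * The second moment of the normal law *)

(** The energy is an extended-real integral, while Pythagoras and the product rule for independent
    variables require square-integrable factors; finiteness of the mean energy therefore travels
    through the induction together with the formula. Adaptedness is assumed for the stages, so that
    of the substep is obtained by solving one stage equation for [U k]; a stage exists because the
    weights sum to 1. The noise is given as a limit in L^2(Omega; H^1) of partial sums over the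
    basis [e]: the identity is exact for each partial sum, and Young's inequality with a free
    parameter carries it to the limit in a form that tolerates infinite values. The Wiener process
    is specified by the one-dimensional laws of its increments, so the variance comes from the
    second moment of the normal density, the mean from symmetry and the covariances from
    polarization. The coordinates on S_N are the real and imaginary parts of the coefficients at
    frequencies 1 to [N], those at negative frequencies being their conjugates. *)

Section NormalSecondMoment.
Context {R : realType}.
Local Notation mu := (@lebesgue_measure R).
Import gauss_integral_proof.

Let sqrtpi : R := Num.sqrt pi.

Let sqrtpi_gt0 : 0 < sqrtpi.
Proof. by rewrite sqrtr_gt0 pi_gt0. Qed.

Let x2gauss (x : R) : R := x ^+ 2 * gauss_fun x.

Let x2gauss_ge0 x : 0 <= x2gauss x.
Proof. by rewrite mulr_ge0 ?sqr_ge0 ?gauss_fun_ge0. Qed.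

Let x2gauss_continuous : continuous x2gauss.
Proof.
move=> x; apply: cvgM; last exact: continuous_gauss_fun.
exact: sqr_continuous.
Qed.

Let derive_xgauss (x : R) :
  is_derive x 1 (fun y : R => y * gauss_fun y) (gauss_fun x - 2 * x2gauss x).
Proof.
rewrite /gauss_fun /x2gauss /gauss_fun.
apply: is_derive_eq.
by rewrite /GRing.scale /=; ring.
Qed.

(** The known limit is that of the square, [pi / 4]; the integral is nonnegative, so a square root
    recovers it. *)
Let cvg_integral0_gauss : @integral0_gauss R x @[x --> +oo] --> sqrtpi / 2.
Proof.
have : Num.sqrt (@integral0_gauss R x ^+ 2) @[x --> +oo] --> Num.sqrt (pi / 4).
  apply: continuous_cvg; first exact: sqrt_continuous.
  exact: cvg_integral0_gauss_sqr.
have -> : Num.sqrt (pi / 4) = sqrtpi / 2 :> R.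
  rewrite /sqrtpi.
  rewrite sqrtrM ?pi_ge0// sqrtrV// (_ : 4 = 2 ^+ 2); last by rewrite expr2 -natrM.
  by rewrite sqrtr_sqr ger0_norm.
rewrite (_ : (fun x => Num.sqrt _) = integral0_gauss)//.
by apply/funext => r; rewrite sqrtr_sqr ger0_norm// integral0_gauss_ge0.
Qed.

(** Follows from [exp (x^2) >= 1 + x^2 >= x^2]. *)
Let xgauss_le (x : R) : 0 < x -> x * gauss_fun x <= x^-1.
Proof.
move=> x0; rewrite /gauss_fun expRN ler_pdivrMr ?expR_gt0// ler_pdivlMl//.
by apply: le_trans (expR_ge1Dx _); rewrite -expr2 lerDr.
Qed.

Let cvg_xgauss : (x * gauss_fun x : R) @[x --> +oo] --> (0 : R).
Proof.
apply: (@squeeze_cvgr _ _ _ _ (cst 0) (fun x : R => x^-1)).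
- near=> x.
  have x0 : 0 < x by near: x; exact: nbhs_pinfty_gt.
  by rewrite /= mulr_ge0 ?gauss_fun_ge0 ?(ltW x0)//= xgauss_le.
- exact: cvg_cst.
- apply/gtr0_cvgV0; last exact: cvg_id.
  by near=> x; near: x; exact: nbhs_pinfty_gt.
Unshelve. all: end_near. Qed.

Let derive_integral0_gauss (x : R) : 0 < x -> is_derive x 1 integral0_gauss (gauss_fun x).
Proof.
move=> x0.
have [dF F'] : derivable integral0_gauss x 1 /\ integral0_gauss^`()%classic x = gauss_fun x.
  (* [x + 1] is just a point to the right of [x]: differentiability at [x] requires integrability up
     to some larger bound. *)
  apply: (@continuous_FTC1 R gauss_fun (BLeft 0) _ (x + 1)).
  - by rewrite ltrDl.
  - apply: continuous_compact_integrable => //; first exact: segment_compact.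
    by apply: continuous_subspaceT; exact: continuous_gauss_fun.
  - by rewrite /= lte_fin.
  - by move=> ?; exact: continuous_gauss_fun.
by apply: DeriveDef dF _; rewrite -derive1E.
Qed.

Let integral0y_x2gauss :
  (\int[mu]_(x in `[0%R, +oo[) (x2gauss x)%:E)%E = (sqrtpi / 4)%:E.
Proof.
(* Integration by parts: since [x * gauss_fun x] has derivative [gauss_fun x - 2 * x2gauss x], this
   [F] is a primitive of [x2gauss]. *)
pose F (x : R) : R := 2^-1 * (integral0_gauss x - x * gauss_fun x).
have F' (x : R) : 0 < x -> is_derive x 1 F (x2gauss x).
  move=> x0; have := derive_integral0_gauss x0 => Dg.
  have := derive_xgauss x => Dxg.
  rewrite /F; apply: is_derive_eq. by rewrite /GRing.scale /=; field.
transitivity ((sqrtpi / 4)%:E - (F 0)%:E)%E; last first.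
  by rewrite /F mul0r subr0 /integral0_gauss set_itv1 Rintegral_set1 mulr0 sube0.
apply: ge0_continuous_FTC2y => //.
- by apply: continuous_subspaceT; exact: x2gauss_continuous.
- rewrite (_ : sqrtpi / 4 = 2^-1 * (sqrtpi / 2 - 0)); last by field.
  apply: cvgM; first exact: cvg_cst.
  by apply: cvgB; [exact: cvg_integral0_gauss|exact: cvg_xgauss].
- by move=> x x0; have [] := F' x x0.
- have c0 : integral0_gauss x @[x --> 0^'+] --> @integral0_gauss R 0.
    have ic : mu.-integrable `[0, 1] (EFin \o @gauss_fun R).
      apply: continuous_compact_integrable; first exact: segment_compact.
      by apply: continuous_subspaceT; exact: continuous_gauss_fun.
    have := parameterized_integral_continuous ler01 ic.
    by move=> /(continuous_within_itvP _ ltr01)[].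
  apply: cvgM; first exact: cvg_cst.
  apply: cvgB; first exact: c0.
  apply: cvg_at_right_filter.
  by apply: cvgM; [exact: cvg_id|exact: continuous_gauss_fun].
- by move=> x; rewrite in_itv/= andbT => x0; have [_ <-] := F' x x0; rewrite derive1E.
Qed.

Let integralT_x2gauss : (\int[mu]_x (x2gauss x)%:E)%E = (sqrtpi / 2)%:E.
Proof.
rewrite ge0_symfun_integralT//=.
- rewrite (_ : [set x | _] = `[0, +oo[%classic); last first.
    by apply/seteqP; split => x/=; rewrite in_itv/= andbT.
  by rewrite integral0y_x2gauss -EFinM; congr (_%:E); field.
- by move=> x/=; rewrite /x2gauss /gauss_fun sqrrN.
Qed.

Let integral_sqr_normal_pdf (s : R) : 0 < s ->
  (\int[mu]_x ((x ^+ 2)%:E * (normal_pdf 0 s x)%:E))%E = (s ^+ 2)%:E.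
Proof.
move=> s0.
(* The substitution [y = x / (s * sqrt 2)] turns the normal density into [gauss_fun]; the constant
   in [G] absorbs the Jacobian and the normalization, so that [G (x * c) * c] is the integrand. *)
pose c := (s * Num.sqrt 2)^-1.
have c0 : 0 < c by rewrite invr_gt0 mulr_gt0// sqrtr_gt0.
pose G (x : R) := 2 * s ^+ 2 / sqrtpi * x2gauss x.
have k0 : 0 <= 2 * s ^+ 2 / sqrtpi by rewrite divr_ge0 ?mulr_ge0 ?sqr_ge0// ltW.
have F'E : (fun x : R => x * c)^`()%classic = cst c.
  apply/funext => x; rewrite derive1E.
  by apply: derive_val; apply: is_derive_eq; rewrite /GRing.scale /=; ring.
have key x : G (x * c) * c = x ^+ 2 * normal_pdf 0 s x.
  rewrite normal_pdfE ?gt_eqF// /G /x2gauss /gauss_fun /normal_fun /normal_peak subr0.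
  have -> : - (x * c) ^+ 2 = - x ^+ 2 / (s ^+ 2 *+ 2).
    by rewrite /c exprMn exprVn exprMn sqr_sqrtr// mulNr mulr_natr.
  rewrite -[s ^+ 2 * pi *+ 2]mulr_natr sqrtrM; last by rewrite mulr_ge0 ?sqr_ge0 ?pi_ge0.
  rewrite sqrtrM ?sqr_ge0// sqrtr_sqr gtr0_norm// -/sqrtpi /c.
  have : Num.sqrt 2 ^+ 2 = 2 :> R by rewrite sqr_sqrtr.
  have : Num.sqrt 2 != 0 :> R by rewrite gt_eqF// sqrtr_gt0.
  move: (Num.sqrt 2) => r r0 r2; rewrite -[in 2 * s ^+ 2]r2.
  by field; rewrite r0 !gt_eqF.
transitivity (\int[mu]_x (G x)%:E)%E.
  rewrite (@increasing_ge0_integration_by_substitutionT _ (fun x => x * c) G).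
  - by apply: eq_integral => x _; rewrite F'E -EFinM -key.
  - by move=> x y xy; rewrite ltr_pM2r.
  - by rewrite F'E => ?; exact: cvg_cst.
  - by rewrite F'E; exact: is_cvg_cst.
  - by rewrite F'E; exact: is_cvg_cst.
  - by move=> x; exact: ex_derive.
  - by apply/gt0_cvgMlNy.
  - by apply/gt0_cvgMly.
  - by move=> x; apply: cvgM; [exact: cvg_cst|exact: x2gauss_continuous].
  - by move=> x; rewrite mulr_ge0.
under eq_integral do rewrite EFinM.
rewrite ge0_integralZl//; last 2 first.
- by apply/measurable_EFinP; exact: continuous_measurable_fun.
- by move=> x _; rewrite lee_fin.
rewrite integralT_x2gauss -EFinM; congr (_%:E).
by field; rewrite gt_eqF.
Qed.

(** Over every measurable set both functions integrate to the normal probability of that set, which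
    determines them almost everywhere. *)
Let Radon_Nikodym_normal_prob (m s : R) :
  ae_eq mu setT (Radon_Nikodym_SigmaFinite.f (normal_prob m s) mu)
    (fun x => (normal_pdf m s x)%:E).
Proof.
apply: integral_ae_eq => //.
- apply: Radon_Nikodym_SigmaFinite.f_integrable; exact: normal_prob_dominates.
- by apply/measurable_EFinP; exact: measurable_normal_pdf.
- move=> E _ mE; rewrite -Radon_Nikodym_SigmaFinite.f_integral//.
  exact: normal_prob_dominates.
Qed.

Lemma ge0_integral_normal_prob (m s : R) (f : R -> \bar R) :
  measurable_fun setT f -> (forall x, 0 <= f x)%E ->
  (\int[normal_prob m s]_x f x = \int[mu]_x (f x * (normal_pdf m s x)%:E))%E.
Proof.
move=> mf f0.
have dom := normal_prob_dominates m s.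
rewrite -(Radon_Nikodym_SigmaFinite.change_of_variables dom)//.
apply: ae_eq_integral => //.
- apply: emeasurable_funM => //.
  exact: measurable_int (Radon_Nikodym_SigmaFinite.f_integrable dom).
- by apply: emeasurable_funM => //; apply/measurable_EFinP; exact: measurable_normal_pdf.
- exact/ae_eqe_mul2l/Radon_Nikodym_normal_prob.
Qed.

Lemma integral_sqr_normal_prob (s : R) : 0 < s ->
  (\int[normal_prob 0 s]_x (x ^+ 2)%:E)%E = (s ^+ 2)%:E.
Proof.
move=> s0; rewrite ge0_integral_normal_prob.
- exact: integral_sqr_normal_pdf.
- by apply/measurable_EFinP; exact: exprn_measurable.
- by move=> x; rewrite lee_fin sqr_ge0.
Qed.

End NormalSecondMoment.

(** * Square-integrable random variables *)

Section SquareIntegrable.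
Context {R : realType} {d : measure_display} {Omega : measurableType d}
  (P : probability Omega R).
Implicit Types X Y : Omega -> R.

Lemma Lfun2P X : X \in Lfun P 2%:E <->
  measurable_fun setT X /\ (\int[P]_w (X w ^+ 2)%:E < +oo)%E.
Proof.
split=> [X2|[mX X2]].
  split; first by have /[!inE] := sub_Lfun_mfun X2.
  have /integrableP[_] := Lfun2_integrable_sqr X2; apply: le_lt_trans.
  by under [leRHS]eq_integral do rewrite /= ger0_norm ?sqr_ge0//.
rewrite inE/=; apply/andP; split; rewrite inE//=.
rewrite /finite_norm unlock poweR_lty//.
by under eq_integral => w _ do rewrite /= powR_mulrn// real_normK ?num_real//.
Qed.

Lemma Lfun2_measurable X : X \in Lfun P 2%:E -> measurable_fun setT X.
Proof. by move=> /Lfun2P[]. Qed.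

Lemma Lfun2_integrableM X Y : X \in Lfun P 2%:E -> Y \in Lfun P 2%:E ->
  P.-integrable setT (EFin \o (fun w => X w * Y w)).
Proof. by move=> X2 Y2; apply/Lfun1_integrable; exact: Lfun2_mul_Lfun1. Qed.

Lemma Lfun2_integrable X : X \in Lfun P 2%:E -> P.-integrable setT (EFin \o X).
Proof.
move=> X2; apply/Lfun1_integrable; apply: Lfun_subset12 => //.
exact: fin_num_measure.
Qed.

Lemma Lfun2D X Y : X \in Lfun P 2%:E -> Y \in Lfun P 2%:E ->
  (fun w => X w + Y w) \in Lfun P 2%:E.
Proof.
by move=> X2 Y2; exact: (Lfun_addr_closed P (lee1n 2)).2.
Qed.

Lemma Lfun2Zr X (c : R) : X \in Lfun P 2%:E -> (fun w => X w * c) \in Lfun P 2%:E.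
Proof.
by move=> X2; have := Lfun_scale c (lee1n 2) X2.
Qed.

Lemma integral_sqr_Rintegral X : X \in Lfun P 2%:E ->
  (\int[P]_w (X w ^+ 2)%:E)%E = (\int[P]_w (X w ^+ 2))%:E.
Proof.
move=> X2; rewrite /Rintegral fineK//.
exact: integrable_fin_num (Lfun2_integrable_sqr X2).
Qed.

(** The joint law of [(X, Y)] agrees with the product of the marginal laws on rectangles, hence
    everywhere; Fubini for the function [x * y] then separates the two means. *)
Lemma Rintegral_indepM X Y :
  measurable_fun setT X -> measurable_fun setT Y ->
  P.-integrable setT (EFin \o X) -> P.-integrable setT (EFin \o Y) ->
  P.-integrable setT (EFin \o (fun w => X w * Y w)) ->
  (forall A B : set R, measurable A -> measurable B ->
     P (X @^-1` A `&` Y @^-1` B) = (P (X @^-1` A) * P (Y @^-1` B))%E) ->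
  \int[P]_w (X w * Y w) = (\int[P]_w X w) * (\int[P]_w Y w).
Proof.
move=> mX mY iX iY iXY indep.
pose X' : {mfun Omega >-> R} := HB.pack X (isMeasurableFun.Build _ _ _ _ X mX).
pose Y' : {mfun Omega >-> R} := HB.pack Y (isMeasurableFun.Build _ _ _ _ Y mY).
pose Z w := (X w, Y w).
have mZ : measurable_fun setT Z by exact/measurable_fun_pair.
pose Z' : {mfun Omega >-> (R * R)%type} := HB.pack Z (isMeasurableFun.Build _ _ _ _ Z mZ).
pose m1 := distribution P X'; pose m2 := distribution P Y'.
pose f (z : R * R) : \bar R := (z.1 * z.2)%:E.
have mf : measurable_fun setT f by apply/measurable_EFinP; exact: measurable_funM.
have prodE A : measurable A -> (m1 \x m2)%E A = distribution P Z' A.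
  by move=> mA; apply: product_measure_unique.
have i_f : (m1 \x m2)%E.-integrable setT f.
  apply/integrableP; split=> //.
  rewrite (eq_measure_integral (distribution P Z')); last first.
    by move=> A mA _; exact: prodE.
  have /integrableP[_] := @integrable_pushforward _ _ _ _ _ Z mZ P setT f mf iXY measurableT.
  exact.
have mE : measurable_fun setT (@EFin R) by exact/measurable_EFinP.
have m1E : (\int[m1]_x x%:E = (\int[P]_w X w)%:E)%E.
  have := @integral_distribution _ _ _ _ _ P X' EFin mE iX.
  move=> ->.
  by rewrite /Rintegral fineK//; exact: integrable_fin_num.
have m2E : (\int[m2]_x x%:E = (\int[P]_w Y w)%:E)%E.
  have := @integral_distribution _ _ _ _ _ P Y' EFin mE iY.
  move=> ->.
  by rewrite /Rintegral fineK//; exact: integrable_fin_num.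
apply: EFin_inj; rewrite EFinM -m1E.
have -> : (\int[P]_w (X w * Y w))%:E = (\int[P]_w (X w * Y w)%:E)%E.
  by rewrite /Rintegral fineK//; exact: integrable_fin_num.
have -> : (\int[P]_w (X w * Y w)%:E)%E = (\int[distribution P Z']_z f z)%E.
  by rewrite integral_distribution.
rewrite (eq_measure_integral (m1 \x m2)%E); last by move=> A mA _; exact/esym/prodE.
rewrite -integral12_prod_meas1// /fubini_F.
rewrite -integralZr//; last first.
  exact: @integrable_pushforward _ _ _ _ _ X mX P setT EFin mE iX measurableT.
apply: eq_integral => x _; rewrite -m2E -integralZl//.
exact: @integrable_pushforward _ _ _ _ _ Y mY P setT EFin mE iY measurableT.
Qed.

End SquareIntegrable.

(** * Moments of centered Gaussian variables *)

Section GaussianMoments.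
Context {R : realType} {d : measure_display} {Omega : measurableType d}
  (P : probability Omega R).
Implicit Types X Y Z : Omega -> R.

Lemma centered_gaussian_integral_sqr X (v : R) : measurable_fun setT X -> 0 < v ->
  centered_gaussian P X v -> (\int[P]_w (X w ^+ 2)%:E = v%:E)%E.
Proof.
move=> mX v0; rewrite /centered_gaussian gt_eqF// => XE.
have mX' : measurable_fun setT (X : Omega -> measurableTypeR R) by exact: mX.
pose X' : {mfun Omega >-> measurableTypeR R} :=
  HB.pack (X : Omega -> measurableTypeR R)
    (isMeasurableFun.Build _ _ _ (measurableTypeR R) _ mX').
have msqr : measurable_fun setT (fun x : measurableTypeR R => (x ^+ 2)%:E).
  by apply/measurable_EFinP; exact: exprn_measurable.
transitivity (\int[distribution P X']_x (x ^+ 2)%:E)%E.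
  by rewrite ge0_integral_distribution// => x; rewrite lee_fin sqr_ge0.
transitivity (\int[normal_prob 0 (Num.sqrt v)]_x (x ^+ 2)%:E)%E.
  by apply: eq_measure_integral => A mA _; exact: XE.
by rewrite integral_sqr_normal_prob ?sqrtr_gt0// sqr_sqrtr// ltW.
Qed.

Lemma centered_gaussian_Lfun2 X (v : R) : measurable_fun setT X -> 0 < v ->
  centered_gaussian P X v -> X \in Lfun P 2%:E.
Proof.
move=> mX v0 gX; apply/Lfun2P; split => //.
by rewrite (centered_gaussian_integral_sqr mX v0 gX) ltry.
Qed.

(** Symmetry replaces a computation of the first moment: [X] and [Y] have the same law, hence the
    same mean, and [Y = - X] makes the two means opposite. In the application [Y] is the Wiener
    increment in the opposite direction. *)
Lemma centered_gaussian_integral0 X Y (v : R) :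
  measurable_fun setT X -> measurable_fun setT Y -> 0 < v ->
  centered_gaussian P X v -> centered_gaussian P Y v ->
  {ae P, forall w, Y w = - X w} -> \int[P]_w X w = 0.
Proof.
move=> mX mY v0 gX gY YX.
have iX := Lfun2_integrable (centered_gaussian_Lfun2 mX v0 gX).
have iY := Lfun2_integrable (centered_gaussian_Lfun2 mY v0 gY).
pose X' : {mfun Omega >-> R} := HB.pack X (isMeasurableFun.Build _ _ _ _ X mX).
pose Y' : {mfun Omega >-> R} := HB.pack Y (isMeasurableFun.Build _ _ _ _ Y mY).
have mE : measurable_fun setT (@EFin R) by exact: EFin_measurable.
have XYE : \int[P]_w X w = \int[P]_w Y w.
  congr fine.
  transitivity (\int[distribution P X']_x x%:E)%E; first by rewrite integral_distribution.
  transitivity (\int[distribution P Y']_x x%:E)%E; last by rewrite integral_distribution.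
  apply: eq_measure_integral => A mA _.
  move: gX gY; rewrite /centered_gaussian gt_eqF// => gX gY.
  exact: etrans (gX _ mA) (esym (gY _ mA)).
have YNX : \int[P]_w Y w = - \int[P]_w X w.
  rewrite -mulN1r -RintegralZl//; congr fine.
  apply: ae_eq_integral => //.
  - exact/measurable_EFinP.
  - by apply/measurable_EFinP; exact: measurable_funM.
  - by apply: filterS YX => w -> _; rewrite mulN1r.
by apply/eqP; rewrite -[_ == _](mulrn_eq0 _ 2) mulr2n {2}XYE YNX subrr.
Qed.

End GaussianMoments.

(** * Orthogonal sums and limits of second moments *)

Section L2Series.
Context {R : realType} {d : measure_display} {Omega : measurableType d}
  (P : probability Omega R).
Implicit Types X Y : Omega -> R.

(** Pythagoras in L^2(Omega). The induction carries, besides the formula, square integrability of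
    the partial sum and its orthogonality to all later [Z j], which kills the next cross term. *)
Lemma integral_sqr_orthogonal_sum Y (Z : nat -> Omega -> R) (tau : R) (g : nat -> R) n :
  Y \in Lfun P 2%:E -> (forall j, Z j \in Lfun P 2%:E) ->
  (forall j, \int[P]_w (Y w * Z j w) = 0) ->
  (forall i j, \int[P]_w (Z i w * Z j w) = tau * (i == j)%:R) ->
  (\int[P]_w ((Y w + \sum_(j < n) Z j w * g j) ^+ 2)%:E =
   \int[P]_w (Y w ^+ 2)%:E + (tau * \sum_(j < n) g j ^+ 2)%:E)%E.
Proof.
move=> Y2 Z2 YZ ZZ.
pose Yn n w := Y w + \sum_(j < n) Z j w * g j.
have YnS m : Yn m.+1 = fun w => Yn m w + Z m w * g m.
  by apply/funext => w; rewrite /Yn big_ord_recr addrA.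
have Yn0 : Yn 0%N = Y by apply/funext => w; rewrite /Yn big_ord0 addr0.
have [Yn2 _ E] : [/\ Yn n \in Lfun P 2%:E,
    forall j, (n <= j)%N -> \int[P]_w (Yn n w * Z j w) = 0 &
    \int[P]_w (Yn n w ^+ 2) = \int[P]_w (Y w ^+ 2) + tau * \sum_(j < n) g j ^+ 2].
  elim: n => [|n [Yn2 YnZ E]]; first by rewrite big_ord0 mulr0 addr0 Yn0.
  have Zg2 := Lfun2Zr (g n) (Z2 n).
  rewrite YnS; split; first exact: Lfun2D.
  - move=> j nj.
    transitivity (\int[P]_w (Yn n w * Z j w + g n * (Z n w * Z j w))).
      by apply: eq_Rintegral => w _; ring.
    rewrite RintegralD//.
    + rewrite RintegralZl//; last exact: Lfun2_integrableM.
      by rewrite YnZ ?(ltnW nj)// ZZ (ltn_eqF nj) mulr0 mulr0 addr0.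
    + exact: Lfun2_integrableM.
    + apply: (eq_integrable _ (EFin \o (fun w => (Z n w * g n) * Z j w))) => //.
        by move=> w _ /=; congr EFin; ring.
      exact: Lfun2_integrableM.
  - transitivity (\int[P]_w ((Yn n w ^+ 2 + 2 * g n * (Yn n w * Z n w)) +
                              g n ^+ 2 * (Z n w * Z n w))).
      by apply: eq_Rintegral => w _; ring.
    have i1 := Lfun2_integrable_sqr Yn2.
    have i2 := Lfun2_integrableM Yn2 (Z2 n).
    have i3 := Lfun2_integrableM (Z2 n) (Z2 n).
    have i2' : P.-integrable setT (EFin \o (fun w => 2 * g n * (Yn n w * Z n w))).
      exact: (integrableZl measurableT (2 * g n) i2).
    have i3' : P.-integrable setT (EFin \o (fun w => g n ^+ 2 * (Z n w * Z n w))).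
      exact: (integrableZl measurableT (g n ^+ 2) i3).
    rewrite RintegralD//; last exact: (integrableD measurableT i1 i2').
    rewrite RintegralD// !RintegralZl// YnZ// ZZ eqxx E big_ord_recr /=; ring.
by rewrite !integral_sqr_Rintegral// -EFinD -E.
Qed.

(** The epsilon criterion in the multiplicative form produced by Young's inequality; [y] may be
    infinite. *)
Lemma lee_mul1Dgt0Pr (x y : \bar R) : (0 <= y)%E ->
  (forall e : R, 0 < e -> (x <= (1 + e)%:E * y)%E) -> (x <= y)%E.
Proof.
case: y => [y| |]//; last by move=> _ _; rewrite leey.
rewrite lee_fin => y0 xy; apply/lee_addgt0Pr => e e0.
have y1 : 0 < y + 1 by rewrite ltr_wpDl.
(* The slack [e / (y + 1)] costs at most [e * y / (y + 1) <= e]; the [+ 1] keeps the denominator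
   positive when [y = 0]. *)
apply: le_trans (xy (e / (y + 1)) (divr_gt0 e0 y1)) _.
rewrite -EFinM -EFinD lee_fin mulrDl mul1r lerD2l mulrAC ler_pdivrMr// ler_pM2l//.
by rewrite lerDl.
Qed.

Lemma le_integral_perturb (g h k : Omega -> \bar R) (e : R) : 0 < e ->
  measurable_fun setT g -> (forall w, 0 <= g w)%E ->
  measurable_fun setT h -> (forall w, 0 <= h w)%E ->
  measurable_fun setT k -> (forall w, 0 <= k w)%E ->
  (forall w, (g w <= (1 + e)%:E * h w + (1 + e^-1)%:E * k w)%E) ->
  (\int[P]_w g w <= (1 + e)%:E * (\int[P]_w h w) + (1 + e^-1)%:E * (\int[P]_w k w))%E.
Proof.
move=> e0 mg g0 mh h0 mk k0 ghk.
have e1 : (0 <= (1 + e)%:E)%E by rewrite lee_fin addr_ge0// ltW.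
have e2 : (0 <= (1 + e^-1)%:E)%E by rewrite lee_fin addr_ge0// invr_ge0 ltW.
rewrite -ge0_integralZl// -[X in (_ <= _ + X)%E]ge0_integralZl//.
rewrite -ge0_integralD//; last 4 first.
- by move=> w _; rewrite mule_ge0.
- exact: measurable_funeM.
- by move=> w _; rewrite mule_ge0.
- exact: measurable_funeM.
apply: ge0_le_integral => //.
- by apply: emeasurable_funD; exact: measurable_funeM.
Qed.

(* The two pointwise bounds hold for squared norms of vectors at squared
   distance [dn]; with them, L^2 convergence gives convergence of the squared
   norms without any integrability assumption. *)
Lemma cvg_integral_sqr_perturb (f : Omega -> \bar R) (fn dn : nat -> Omega -> \bar R)
    (l : \bar R) :
  measurable_fun setT f -> (forall w, 0 <= f w)%E ->
  (forall n, measurable_fun setT (fn n)) -> (forall n w, 0 <= fn n w)%E ->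
  (forall n, measurable_fun setT (dn n)) -> (forall n w, 0 <= dn n w)%E ->
  (forall (e : R) n w, 0 < e -> (f w <= (1 + e)%:E * fn n w + (1 + e^-1)%:E * dn n w)%E) ->
  (forall (e : R) n w, 0 < e -> (fn n w <= (1 + e)%:E * f w + (1 + e^-1)%:E * dn n w)%E) ->
  (fun n => \int[P]_w dn n w)%E @ \oo --> 0%E ->
  (fun n => \int[P]_w fn n w)%E @ \oo --> l ->
  (\int[P]_w f w = l)%E.
Proof.
move=> mf f0 mfn fn0 mdn dn0 ffn fnf dn_0 fn_l.
have l0 : (0 <= l)%E.
  apply: cvge_to_ge fn_l _.
  by near=> n; apply: integral_ge0 => w _; exact: fn0.
have cvg_dn (e : R) : ((1 + e^-1)%:E * (\int[P]_w dn n w))%E @[n --> \oo] --> 0%E.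
  by rewrite -[X in _ --> X](mule0 (1 + e^-1)%:E); exact: cvgeZl.
apply/eqP; rewrite eq_le; apply/andP; split.
(* The order of limits matters: for fixed [e] the [dn] term vanishes as [n] grows, in spite of its
   large factor [1 + e^-1], and only afterwards is [e] removed. *)
- apply: lee_mul1Dgt0Pr => // e e0.
  have : ((1 + e)%:E * (\int[P]_w fn n w) + (1 + e^-1)%:E * (\int[P]_w dn n w))%E
      @[n --> \oo] --> ((1 + e)%:E * l)%E.
    rewrite -[X in _ --> X]adde0; apply: cvgeD => //.
    + by rewrite fin_num_adde_defl.
    + exact: cvgeZl.
  move=> c; apply: cvge_to_ge c _.
  by near=> n; apply: le_integral_perturb => // w; exact: ffn.
- apply: lee_mul1Dgt0Pr => [|e e0]; first exact: integral_ge0.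
  have : ((1 + e)%:E * (\int[P]_w f w) + (1 + e^-1)%:E * (\int[P]_w dn n w))%E
      @[n --> \oo] --> ((1 + e)%:E * (\int[P]_w f w))%E.
    rewrite -[X in _ --> X]adde0; apply: cvgeD => //.
    + by rewrite fin_num_adde_defl.
    + exact: cvg_cst.
  move=> c; apply: lee_cvg_to fn_l c _.
  by near=> n; apply: le_integral_perturb => // w; exact: fnf.
Unshelve. all: end_near. Qed.

End L2Series.

(** * Weighted energy of a vector perturbed by a noise series *)

Section AdditiveNoise.
Context {R : realType} {d : measure_display} {Omega : measurableType d}
  (P : probability Omega R) (I : finType) (wt : I -> R).
(** In the application [Y] holds the coordinates of the Runge-Kutta substep, [X] those of the noise,
    [Z j] is the Wiener increment along [e j], and [g j] holds the coordinates of [G (e j)]. *)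
Variables (Y X : I -> Omega -> R) (Z : nat -> Omega -> R) (g : nat -> I -> R) (tau : R).
Hypotheses (wt0 : forall p, 0 <= wt p) (tau0 : 0 <= tau)
  (Y2 : forall p, Y p \in Lfun P 2%:E) (Z2 : forall j, Z j \in Lfun P 2%:E)
  (YZ : forall p j, \int[P]_w (Y p w * Z j w) = 0)
  (ZZ : forall i j, \int[P]_w (Z i w * Z j w) = tau * (i == j)%:R)
  (mX : forall p, measurable_fun setT (X p))
  (XZ : (fun n => \int[P]_w (\sum_p wt p * (X p w - \sum_(j < n) Z j w * g j p) ^+ 2)%:E)%E
          @ \oo --> 0%E).

Let qnorm (V : I -> R) : R := \sum_p wt p * V p ^+ 2.

Let qnorm_ge0 V : 0 <= qnorm V.
Proof. by apply: sumr_ge0 => p _; rewrite mulr_ge0 ?sqr_ge0. Qed.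

Let measurable_qnorm (V : I -> Omega -> R) : (forall p, measurable_fun setT (V p)) ->
  measurable_fun setT (fun w => (qnorm (V ^~ w))%:E).
Proof.
move=> mV; apply/measurable_EFinP; apply: measurable_sum => p.
by apply: measurable_funM => //; exact: measurable_funX.
Qed.

(* Young's inequality: [2 y z <= eps y^2 + z^2 / eps] *)
Let qnorm_perturb (V U : I -> R) (eps : R) : 0 < eps ->
  qnorm V <= (1 + eps) * qnorm U + (1 + eps^-1) * qnorm (fun p => V p - U p).
Proof.
move=> e0; rewrite /qnorm !mulr_sumr -big_split; apply: ler_sum => p _ /=.
rewrite -subr_ge0 (_ : _ - _ = wt p * (eps^-1 * (eps * U p - (V p - U p)) ^+ 2)).
  by rewrite mulr_ge0// mulr_ge0 ?sqr_ge0 ?invr_ge0 ?(ltW e0).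
by field; rewrite gt_eqF.
Qed.

Let S n p w := \sum_(j < n) Z j w * g j p.

Let mS n p : measurable_fun setT (S n p).
Proof.
apply: measurable_sum => j; apply: measurable_funM => //.
exact: Lfun2_measurable (Z2 _).
Qed.

Let mY p : measurable_fun setT (Y p).
Proof. exact: Lfun2_measurable. Qed.

Let f w := (qnorm (fun p => Y p w + X p w))%:E.
Let fn n w := (qnorm (fun p => Y p w + S n p w))%:E.
Let dn n w := (qnorm (fun p => X p w - S n p w))%:E.

Let mf : measurable_fun setT f.
Proof. by apply: measurable_qnorm => p; exact: measurable_funD. Qed.

Let mfn n : measurable_fun setT (fn n).
Proof. by apply: measurable_qnorm => p; exact: measurable_funD. Qed.

Let mdn n : measurable_fun setT (dn n).
Proof. by apply: measurable_qnorm => p; exact: measurable_funB. Qed.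

Let ffn (eps : R) n w : 0 < eps ->
  (f w <= (1 + eps)%:E * fn n w + (1 + eps^-1)%:E * dn n w)%E.
Proof.
move=> e0; rewrite -!EFinM -EFinD lee_fin.
apply: le_trans (qnorm_perturb _ (fun p => Y p w + S n p w) e0) _.
rewrite lerD2l ler_wpM2l ?addr_ge0 ?invr_ge0 ?(ltW e0)// ler_sum// => p _.
by rewrite ler_wpM2l// le_eqVlt; apply/orP; left; apply/eqP; ring.
Qed.

Let fnf (eps : R) n w : 0 < eps ->
  (fn n w <= (1 + eps)%:E * f w + (1 + eps^-1)%:E * dn n w)%E.
Proof.
move=> e0; rewrite -!EFinM -EFinD lee_fin.
apply: le_trans (qnorm_perturb _ (fun p => Y p w + X p w) e0) _.
rewrite lerD2l ler_wpM2l ?addr_ge0 ?invr_ge0 ?(ltW e0)// ler_sum// => p _.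
by rewrite ler_wpM2l// le_eqVlt; apply/orP; left; apply/eqP; ring.
Qed.

Let integral_qnorm (V : I -> Omega -> R) : (forall p, measurable_fun setT (V p)) ->
  (\int[P]_w (qnorm (V ^~ w))%:E = \sum_p (wt p)%:E * \int[P]_w (V p w ^+ 2)%:E)%E.
Proof.
move=> mV; rewrite /qnorm; under eq_integral do rewrite -sumEFin.
have mV2 p : measurable_fun setT (fun w => (V p w ^+ 2)%:E).
  by apply/measurable_EFinP; exact: measurable_funX.
rewrite ge0_integral_sum//.
- apply: eq_bigr => p _; under eq_integral do rewrite EFinM.
  by rewrite ge0_integralZl// => [w _|]; rewrite lee_fin ?sqr_ge0.
- by move=> p; under eq_fun do rewrite EFinM; exact: measurable_funeM.
- by move=> p w _; rewrite lee_fin mulr_ge0 ?sqr_ge0.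
Qed.

Let integral_fn n : (\int[P]_w fn n w =
  \int[P]_w (qnorm (Y ^~ w))%:E + tau%:E * \sum_(0 <= j < n) (qnorm (g j))%:E)%E.
Proof.
rewrite (integral_qnorm (V := fun p w => Y p w + S n p w)); last first.
  by move=> p; exact: measurable_funD.
rewrite integral_qnorm// big_mkord sumEFin -EFinM.
have EY p := integral_sqr_Rintegral (Y2 p).
rewrite (eq_bigr (fun p => (wt p * (\int[P]_w (Y p w ^+ 2)) +
    tau * \sum_(j < n) wt p * g j p ^+ 2)%:E)); last first.
  move=> p _; rewrite (integral_sqr_orthogonal_sum (g ^~ p) n (Y2 p) Z2 (YZ p) ZZ).
  by rewrite [X in (_ * (X + _))%E](EY p) -EFinD -EFinM -mulr_sumr; congr EFin; ring.
rewrite [X in _ = (X + _)%E](eq_bigr (fun p => (wt p * (\int[P]_w (Y p w ^+ 2)))%:E)); last first.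
  by move=> p _; rewrite [X in (_ * X)%E](EY p) -EFinM.
rewrite !sumEFin -EFinD; congr EFin.
by rewrite big_split /= -mulr_sumr exchange_big.
Qed.

(** With [X] replaced by a partial sum the identity is [integral_fn]; [XZ] says that the error tends
    to 0 in mean square, so both sides pass to the limit. The series on the right is treated as an
    extended real throughout. *)
Lemma integral_additive_noise :
  (\int[P]_w (qnorm (fun p => Y p w + X p w))%:E =
   \int[P]_w (qnorm (Y ^~ w))%:E + tau%:E * \sum_(0 <= j <oo) (qnorm (g j))%:E)%E.
Proof.
apply: (cvg_integral_sqr_perturb mf _ mfn _ mdn _ ffn fnf XZ) => //.
- by move=> w; rewrite lee_fin.
- by move=> n w; rewrite lee_fin.
- by move=> n w; rewrite lee_fin.
rewrite (_ : (fun n => _) = fun n => (\int[P]_w (qnorm (Y ^~ w))%:E +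
    tau%:E * \sum_(0 <= j < n) (qnorm (g j))%:E)%E); last by apply/funext.
have Sge0 : (0 <= \sum_(0 <= j <oo) (qnorm (g j))%:E)%E.
  by apply: nneseries_ge0 => j _ _; rewrite lee_fin.
apply: cvgeD; first last.
- apply: cvgeZl => //; apply: is_cvg_nneseries => j _ _; by rewrite lee_fin.
- exact: cvg_cst.
- rewrite ge0_adde_def// inE; last by rewrite mule_ge0.
  by apply: integral_ge0 => w _; rewrite lee_fin.
Qed.

(** By [XZ] some partial sum lies at mean-square distance below 1 from [X], and [Y] plus this finite
    sum has finite energy; Young's inequality with parameter 1 combines the two. *)
Lemma integral_additive_noise_lty :
  (\int[P]_w (qnorm (fun p => Y p w + X p w))%:E < +oo)%E.
Proof.
have [n dn1] : exists n, (\int[P]_w dn n w < 1)%E.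
  have [n _ dn1] := XZ (open_ereal_lt' (@lte01 R)).
  by exists n; exact: (dn1 n (leqnn n)).
apply: (@le_lt_trans _ _ ((1 + 1)%:E * (\int[P]_w fn n w) + (1 + 1^-1)%:E * (\int[P]_w dn n w))%E).
  apply: le_integral_perturb => //.
  - by move=> w; rewrite lee_fin.
  - by move=> w; rewrite lee_fin.
  - by move=> w; rewrite lee_fin.
  - by move=> w; exact: ffn.
have dnoo : (\int[P]_w dn n w < +oo)%E by rewrite (lt_trans dn1)// ltry.
have fnoo : (\int[P]_w fn n w < +oo)%E.
  rewrite integral_fn sumEFin -EFinM lte_add_pinfty ?ltry//.
  rewrite integral_qnorm//; apply: lte_sum_pinfty => p _.
  by rewrite integral_sqr_Rintegral// -EFinM ltry.
by rewrite lte_add_pinfty// lte_mul_pinfty// lee_fin.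
Qed.

End AdditiveNoise.

(** * Trigonometric polynomials *)

Section FourierModes.
Local Open Scope complex_scope.
Context {R : realType} (a b : R).
Hypothesis ab : a < b.
Local Notation mu := (@lebesgue_measure R).
Local Notation mode := (mode a b).
Local Notation freq := (freq a b).
Local Notation torus := (torus a b).
Local Notation fhat := (fhat a b).
Implicit Types (f g : R -> R) (k l : int) (x : R) (F G : R -> R[i]).

Lemma cisD (s t : R) : cis (s + t) = cis s * cis t.
Proof. by rewrite /cis cosD sinD; simpc; congr (_ +i* _); ring. Qed.

Lemma cis0 : cis (0 : R) = 1.
Proof. by rewrite /cis cos0 sin0. Qed.

Lemma cisN (t : R) : cis (- t) = (cis t)^*.
Proof. by rewrite /cis cosN sinN. Qed.

Lemma cis_2piz k : cis (k%:~R * (2 * pi) : R) = 1.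
Proof.
have cisn (n : nat) : cis (n%:R * (2 * pi) : R) = 1.
  elim: n => [|n IH]; first by rewrite mul0r cis0.
  rewrite -natr1 mulrDl mul1r cisD IH mul1r /cis.
  by rewrite mulrC mulr_natr cos2pi sin2pi.
case: k => n; first exact: cisn.
by rewrite NegzE mulrNz mulNr cisN (cisn n.+1) conjc1.
Qed.

Lemma mode0 x : mode 0 x = 1.
Proof. by rewrite /Defs.mode mul0r mul0r cis0. Qed.

Lemma modeD k l x : mode (k + l) x = mode k x * mode l x.
Proof. by rewrite /Defs.mode -cisD; congr cis; rewrite intrD; ring. Qed.

Lemma modeN k x : mode (- k) x = (mode k x)^*.
Proof. by rewrite /Defs.mode -cisN; congr cis; rewrite mulrNz; ring. Qed.

Lemma freq_gt0 : 0 < freq.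
Proof. by rewrite /Defs.freq divr_gt0 ?mulr_gt0 ?pi_gt0// /len subr_gt0. Qed.

Definition cintegrable F := mu.-integrable torus (EFin \o (@complex.Re R \o F)) /\
  mu.-integrable torus (EFin \o (@complex.Im R \o F)).

Let measurable_torus : measurable (torus : set (measurableTypeR R)).
Proof. exact: measurable_itv. Qed.

Lemma cintegral_linear (c : R[i]) F G : cintegrable F -> cintegrable G ->
  cintegrable (fun x => c * F x + G x) /\
  cintegral a b (fun x => c * F x + G x) = c * cintegral a b F + cintegral a b G.
Proof.
case: c => cr ci [rF iF] [rG iG].
have ReE x : complex.Re ((cr +i* ci) * F x + G x) =
    (cr * complex.Re (F x) + (- ci) * complex.Im (F x)) + complex.Re (G x).
  by case: (F x) (G x) => [u v] [u' v']; simpc => /=; ring.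
have ImE x : complex.Im ((cr +i* ci) * F x + G x) =
    (cr * complex.Im (F x) + ci * complex.Re (F x)) + complex.Im (G x).
  by case: (F x) (G x) => [u v] [u' v']; simpc => /=; ring.
have i1 (r : R) f : mu.-integrable torus (EFin \o f) ->
    mu.-integrable torus (EFin \o (fun x => r * f x)).
  by move=> i_f; exact: (integrableZl measurable_torus r i_f).
have i2 f g : mu.-integrable torus (EFin \o f) -> mu.-integrable torus (EFin \o g) ->
    mu.-integrable torus (EFin \o (fun x => f x + g x)).
  by move=> i_f i_g; exact: (integrableD measurable_torus i_f i_g).
have R1 := i2 _ _ (i1 cr _ rF) (i1 (- ci) _ iF).
have I1 := i2 _ _ (i1 cr _ iF) (i1 ci _ rF).
split.
  split.
  - rewrite (_ : _ \o _ = EFin \o (fun x => (cr * complex.Re (F x) + (- ci) * complex.Im (F x)) + complex.Re (G x))).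
      exact: i2 R1 rG.
    by apply/funext => x /=; rewrite ReE.
  - rewrite (_ : _ \o _ = EFin \o (fun x => (cr * complex.Im (F x) + ci * complex.Re (F x)) + complex.Im (G x))).
      exact: i2 I1 iG.
    by apply/funext => x /=; rewrite ImE.
rewrite /cintegral.
under eq_Rintegral do rewrite ReE.
under [X in _ +i* X = _]eq_Rintegral do rewrite ImE.
rewrite (RintegralD measurable_torus R1 rG) (RintegralD measurable_torus I1 iG).
rewrite (RintegralD measurable_torus (i1 cr _ rF) (i1 (- ci) _ iF)).
rewrite (RintegralD measurable_torus (i1 cr _ iF) (i1 ci _ rF)).
rewrite !RintegralZl//.
by simpc => /=; congr (_ +i* _); ring.
Qed.

Lemma integrable_torus f : continuous f -> mu.-integrable torus (EFin \o f).
Proof.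
move=> cf; apply: (@integrableS _ _ _ mu `[a, b]) => //.
  exact: subset_itv_co_cc.
apply: continuous_compact_integrable; first exact: segment_compact.
exact: continuous_subspaceT.
Qed.

Lemma Rintegral_torus_derive f g : continuous g ->
  (forall x, is_derive x 1 f (g x)) -> \int[mu]_(x in torus) g x = f b - f a.
Proof.
move=> cg f'.
rewrite /Defs.torus Rintegral_itv_bndo_bndc; last exact: integrable_torus.
have cf : continuous f.
  by move=> x; apply/differentiable_continuous/derivable1_diffP; have [] := f' x.
rewrite /Rintegral (continuous_FTC2 ab (F := f)) //.
- exact: continuous_subspaceT.
- split.
  + by move=> x _; have [] := f' x.
  + by apply: cvg_at_right_filter; exact: cf.
  + by apply: cvg_at_left_filter; exact: cf.
- by move=> x _; rewrite derive1E; have [_ ->] := f' x.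
Qed.

Lemma is_derive_mode k x :
  is_derive x 1 (fun y => cos (k%:~R * freq * (y - a)))
    (- (k%:~R * freq) * sin (k%:~R * freq * (x - a))) /\
  is_derive x 1 (fun y => sin (k%:~R * freq * (y - a)))
    (k%:~R * freq * cos (k%:~R * freq * (x - a))).
Proof.
split; apply: is_derive_eq; rewrite /GRing.scale /=; ring.
Qed.

Lemma continuous_mode k : continuous (fun y => cos (k%:~R * freq * (y - a))) /\
  continuous (fun y => sin (k%:~R * freq * (y - a))).
Proof.
have cd f f' : (forall x, is_derive x 1 f (f' x)) -> continuous f.
  by move=> df x; apply/differentiable_continuous/derivable1_diffP; have [] := df x.
split.
- exact: cd (fun x => (is_derive_mode k x).1).
- exact: cd (fun x => (is_derive_mode k x).2).
Qed.

Lemma cintegrable_mode k : cintegrable (mode k).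
Proof. by have [? ?] := continuous_mode k; split; exact: integrable_torus. Qed.

(** The zeroth Fourier coefficient for complex-valued functions; [fhat f k] is [cmean] of [f] times
    [mode (- k)]. *)
Definition cmean F : R[i] := ((len a b)^-1)%:C * cintegral a b F.

(** Orthogonality of the modes. For [k != 0] the real and imaginary parts have explicit primitives,
    which take equal values at [a] and [b] because [k * freq * (b - a)] is a multiple of
    [2 * pi]. *)
Lemma cmean_mode k : cmean (mode k) = (k == 0)%:R.
Proof.
have len_gt0 : 0 < len a b by rewrite subr_gt0.
rewrite /cmean /cintegral; have [->|k0] := eqVneq k 0.
  under eq_Rintegral do rewrite mode0.
  under [X in _ +i* X]eq_Rintegral do rewrite mode0.
  rewrite /= !Rintegral_cst//= mul0r mul1r /Defs.torus lebesgue_measure_itv/= lte_fin ab.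
  rewrite -EFinD /=; simpc.
  by rewrite -/(len a b) mulVf ?gt_eqF//.
have kf0 : k%:~R * freq != 0 by rewrite mulf_neq0 ?intr_eq0// gt_eqF// freq_gt0.
have [cc cs] := continuous_mode k.
have kb : k%:~R * freq * (b - a) = k%:~R * (2 * pi).
  by rewrite /Defs.freq /len; field; rewrite subr_eq0 gt_eqF.
have [cosb sinb] : cos (k%:~R * freq * (b - a)) = 1 /\ sin (k%:~R * freq * (b - a)) = 0.
  by rewrite kb; have [-> ->] := cis_2piz k.
have sk x : is_derive x 1 (fun y => (k%:~R * freq)^-1 * sin (k%:~R * freq * (y - a)))
    (cos (k%:~R * freq * (x - a))).
  have [_ ?] := is_derive_mode k x.
  by apply: is_derive_eq; rewrite /GRing.scale /= mulKf.
have ck x : is_derive x 1 (fun y => - (k%:~R * freq)^-1 * cos (k%:~R * freq * (y - a)))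
    (sin (k%:~R * freq * (x - a))).
  have [? _] := is_derive_mode k x.
  by apply: is_derive_eq; rewrite /GRing.scale /= mulrA mulrNN mulVf ?mul1r.
have -> : \int[mu]_(x in torus) complex.Re (mode k x) = 0.
  by rewrite (Rintegral_torus_derive cc sk) sinb subrr !mulr0 sin0 mulr0 subrr.
have -> : \int[mu]_(x in torus) complex.Im (mode k x) = 0.
  by rewrite (Rintegral_torus_derive cs ck) cosb subrr mulr0 cos0 subrr.
by simpc.
Qed.

End FourierModes.

Section TrigonometricPolynomials.
Local Open Scope complex_scope.
Context {R : realType} (a b : R).
Hypothesis ab : a < b.
Local Notation mu := (@lebesgue_measure R).
Local Notation mode := (mode a b).
Local Notation freq := (freq a b).
Local Notation torus := (torus a b).
Local Notation fhat := (fhat a b).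
Implicit Types (f g : R -> R) (k l : int) (x : R) (s t : seq (R[i] * int)).

(** A trigonometric polynomial is encoded as a list of pairs (coefficient, frequency) in which
    frequencies may repeat. Sums and products then become concatenations and pairwise products with
    no normalization; [coef] collects the repetitions. *)
Definition tp s x : R[i] := \sum_(p <- s) p.1 * mode p.2 x.

Definition coef s k : R[i] := \sum_(p <- s) p.1 *+ (p.2 == k).

Lemma cmean_tp s : cmean a b (tp s) = coef s 0.
Proof.
suff [] : cintegrable a b (tp s) /\ cmean a b (tp s) = coef s 0 by [].
elim: s => [|p s [i_s IH]].
  have -> : tp [::] = fun=> 0 by apply/funext => x; rewrite /tp big_nil.
  rewrite /coef big_nil /cmean /cintegral /= !Rintegral_cst ?mul0r; [|exact: measurable_itv..].
  have i0 : mu.-integrable torus (EFin \o (fun=> 0 : R)).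
    by apply: integrable_torus => x; exact: cvg_cst.
  by split; [|simpc].
have -> : tp (p :: s) = fun x => p.1 * mode p.2 x + tp s x.
  by apply/funext => x; rewrite /tp big_cons.
have [ips E] := cintegral_linear p.1 (cintegrable_mode a b p.2) i_s.
split => //; rewrite /cmean E mulrDr [X in _ + X]IH /coef big_cons; congr (_ + _).
by rewrite mulrCA -[_%:C * _]/(cmean _ _ _) cmean_mode// mulr_natr.
Qed.

Lemma tp_cat s t x : tp (s ++ t) x = tp s x + tp t x.
Proof. by rewrite /tp big_cat. Qed.

Definition tp_scale (c : R[i]) s := [seq (c * p.1, p.2) | p <- s].

Lemma tp_scaleE c s x : tp (tp_scale c s) x = c * tp s x.
Proof. by rewrite /tp big_map mulr_sumr; apply: eq_bigr => p _; rewrite mulrA. Qed.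

Lemma coef_scale c s k : coef (tp_scale c s) k = c * coef s k.
Proof. by rewrite /coef big_map mulr_sumr; apply: eq_bigr => p _; rewrite mulrnAr. Qed.

Definition tp_conj s := [seq (p.1^*, - p.2) | p <- s].

Lemma tp_conjE s x : tp (tp_conj s) x = (tp s x)^*.
Proof.
by rewrite /tp big_map rmorph_sum; apply: eq_bigr => p _; rewrite rmorphM /= modeN.
Qed.

Lemma coef_conj s k : coef (tp_conj s) k = (coef s (- k))^*.
Proof.
rewrite /coef big_map rmorph_sum; apply: eq_bigr => p _ /=.
by rewrite rmorphMn eqr_oppLR.
Qed.

Definition tp_mul s t := [seq (p.1 * q.1, p.2 + q.2) | p <- s, q <- t].

Lemma tp_mulE s t x : tp (tp_mul s t) x = tp s x * tp t x.
Proof.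
rewrite /tp big_allpairs_dep /= mulr_suml; apply: eq_bigr => p _.
by rewrite mulr_sumr; apply: eq_bigr => q _; rewrite modeD mulrACA.
Qed.

Lemma coef_mul s t k : coef (tp_mul s t) k =
  \sum_(p <- s) \sum_(q <- t) p.1 * q.1 *+ (p.2 + q.2 == k).
Proof. by rewrite /coef big_allpairs_dep. Qed.

Definition tp_shift k s := [seq (p.1, p.2 + k) | p <- s].

Lemma tp_shiftE k s x : tp (tp_shift k s) x = tp s x * mode k x.
Proof. by rewrite /tp big_map mulr_suml; apply: eq_bigr => p _; rewrite modeD mulrA. Qed.

Lemma coef_shift k l s : coef (tp_shift k s) l = coef s (l - k).
Proof. by rewrite /coef big_map; apply: eq_bigr => p _ /=; rewrite [in RHS]eq_sym subr_eq eq_sym. Qed.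

Definition tp_derive s := [seq (p.1 * ((p.2%:~R * freq)%:C * 'i%C), p.2) | p <- s].

Lemma coef_derive s k : coef (tp_derive s) k = (k%:~R * freq)%:C * 'i%C * coef s k.
Proof.
rewrite /coef big_map mulr_sumr; apply: eq_bigr => p _ /=.
by have [->|] := eqVneq p.2 k; rewrite ?mulr0n ?mulr0// mulr1n mulrC.
Qed.

Lemma is_derive_tp s x :
  is_derive x 1 (fun y => complex.Re (tp s y)) (complex.Re (tp (tp_derive s) x)) /\
  is_derive x 1 (fun y => complex.Im (tp s y)) (complex.Im (tp (tp_derive s) x)).
Proof.
elim: s => [|[[u v] k] s [IHr IHi]].
  rewrite /tp /tp_derive /=.
  under eq_fun do rewrite big_nil.
  under [X in _ /\ is_derive _ _ X _]eq_fun do rewrite big_nil.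
  by rewrite big_nil; split; exact: is_derive_cst.
have [dc ds] := is_derive_mode a b k x.
split.
- rewrite (_ : (fun y => _) = fun y => u * cos (k%:~R * freq * (y - a))
      - v * sin (k%:~R * freq * (y - a)) + complex.Re (tp s y)).
    apply: is_derive_eq; rewrite /tp /tp_derive /= big_cons -/(tp_derive s).
    by rewrite -/(tp (tp_derive s) x) /GRing.scale /=; case: (tp _ _) => ? ?; simpc => /=; ring.
  by apply/funext => y; rewrite /tp big_cons -/(tp s y) /=; case: (tp _ _) => ? ?; simpc.
- rewrite (_ : (fun y => _) = fun y => u * sin (k%:~R * freq * (y - a))
      + v * cos (k%:~R * freq * (y - a)) + complex.Im (tp s y)).
    apply: is_derive_eq; rewrite /tp /tp_derive /= big_cons -/(tp_derive s).
    by rewrite -/(tp (tp_derive s) x) /GRing.scale /=; case: (tp _ _) => ? ?; simpc => /=; ring.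
  by apply/funext => y; rewrite /tp big_cons -/(tp s y) /=; case: (tp _ _) => ? ?; simpc.
Qed.

End TrigonometricPolynomials.

Section Modes.
Local Open Scope complex_scope.

Lemma real_complexD (R : realType) (u v : R) : (u + v)%:C = u%:C + v%:C.
Proof. by simpc. Qed.

Lemma real_complexM (R : realType) (u v : R) : (u * v)%:C = u%:C * v%:C.
Proof. by simpc. Qed.

Lemma sum_mulrn_pred1 (V : nmodType) (I : eqType) (r : seq I) (F : I -> V) (l : I) :
  uniq r -> \sum_(k <- r) F k *+ (k == l) = if l \in r then F l else 0.
Proof.
move=> ur; case: ifPn => lr.
  rewrite (bigD1_seq l)//= eqxx mulr1n big1 ?addr0// => k /negbTE ->.
  by rewrite mulr0n.
rewrite big_seq big1// => k kr; case: eqVneq => [kl|_]; last by rewrite mulr0n.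
by rewrite -kl kr in lr.
Qed.

(** Listed in the order of the terms of [trig_sum], so that sums over [modes N] split into pairs
    [n], [- n]. *)
Definition modes (N : nat) : seq int :=
  flatten [seq [:: n%:Z; - n%:Z] | n <- index_iota 1 N.+1].

Lemma mem_modes (N : nat) (k : int) : (k \in modes N) = (0 < `|k| <= N)%N.
Proof.
apply/flatten_mapP/idP => [[n]|/andP[k0 kN]].
  by rewrite mem_index_iota ltnS !inE => nN /orP[] /eqP ->; rewrite ?abszN.
exists `|k|%N; first by rewrite mem_index_iota ltnS k0.
by rewrite !inE; case: k {k0 kN} => n /=; rewrite ?eqxx// NegzE eqxx orbT.
Qed.

Lemma modes_uniq (N : nat) : uniq (modes N).
Proof.
have nmem (r : seq nat) (n : nat) k : n \notin r -> `|k|%N = n ->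
    k \notin flatten [seq [:: m%:Z; - m%:Z] | m <- r].
  move=> nr kn; apply: contra nr => /flatten_mapP[m mr].
  by rewrite !inE -kn => /orP[] /eqP ->; rewrite ?abszN.
have r0 : all (fun n => 0 < n)%N (index_iota 1 N.+1).
  by apply/allP => n /=; rewrite mem_index_iota; case/andP.
rewrite /modes; elim: (index_iota 1 N.+1) (iota_uniq 1 (N.+1 - 1) : uniq (index_iota 1 N.+1)) r0 => //= n r IH.
move=> /andP[nr ur] /andP[n0 r0].
apply/and3P; split; last exact: IH.
  rewrite inE negb_or (nmem _ _ _ nr)// andbT.
  by apply/eqP; lia.
by rewrite (nmem _ _ _ nr)// abszN.
Qed.

End Modes.

Section RealTrigonometricPolynomials.
Local Open Scope complex_scope.
Context {R : realType} (a b : R).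
Hypothesis ab : a < b.
Local Notation mode := (mode a b).
Local Notation freq := (freq a b).
Local Notation fhat := (fhat a b).
Implicit Types (f g : R -> R) (k l : int) (x : R) (s t : seq (R[i] * int)).
Implicit Types (c : int -> R[i]).

(** No degree bound is imposed: squares of elements of S_N leave S_N, whereas this class is stable
    under products, derivatives and [Lam]. *)
Definition is_trig f := exists s, forall x, (f x)%:C = tp a b s x.

(** Multiplication by [mode (- k)] moves frequency [k] to 0, where [cmean_tp] reads off the
    coefficient. *)
Lemma fhat_tp f s k : (forall x, (f x)%:C = tp a b s x) -> fhat f k = coef s k.
Proof.
move=> fs; rewrite -[k in RHS](opprK k) -[- - k]add0r -coef_shift -(cmean_tp ab).
rewrite /Defs.fhat -/(cmean a b _); congr cmean; apply/funext => x.
by rewrite fs tp_shiftE.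
Qed.

Lemma is_trigD f g : is_trig f -> is_trig g -> is_trig (fun x => f x + g x).
Proof. by move=> [s fs] [t gt]; exists (s ++ t) => x; rewrite tp_cat real_complexD fs gt. Qed.

Lemma is_trigZ (r : R) f : is_trig f -> is_trig (fun x => r * f x).
Proof. by move=> [s fs]; exists (tp_scale r%:C s) => x; rewrite tp_scaleE real_complexM fs. Qed.

Lemma is_trigM f g : is_trig f -> is_trig g -> is_trig (fun x => f x * g x).
Proof. by move=> [s fs] [t gt]; exists (tp_mul s t) => x; rewrite tp_mulE real_complexM fs gt. Qed.

Lemma is_trig_sqr f : is_trig f -> is_trig (fun x => f x ^+ 2).
Proof. by move=> tf; under eq_fun do rewrite expr2; exact: is_trigM. Qed.

Lemma is_trig_Re s : is_trig (fun x => complex.Re (tp a b s x)).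
Proof.
exists (tp_scale 2^-1 (s ++ tp_conj s)) => x.
by rewrite tp_scaleE tp_cat tp_conjE ReJ_add mulrC.
Qed.

Lemma fhat_Re s k : fhat (fun x => complex.Re (tp a b s x)) k = 2^-1 * (coef s k + (coef s (- k))^*%C).
Proof.
rewrite (@fhat_tp _ (tp_scale 2^-1 (s ++ tp_conj s))).
  by rewrite coef_scale /coef big_cat -/(coef (tp_conj s) k) coef_conj.
by move=> x; rewrite tp_scaleE tp_cat tp_conjE ReJ_add mulrC.
Qed.

Lemma is_trig0 : is_trig (fun=> 0).
Proof. by exists [::] => x; rewrite /tp big_nil. Qed.

Lemma is_trig_sum (I : Type) (r : seq I) (F : I -> R -> R) :
  (forall i, is_trig (F i)) -> is_trig (fun x => \sum_(i <- r) F i x).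
Proof.
move=> tF; elim: r => [|i r IH].
  by under eq_fun do rewrite big_nil; exact: is_trig0.
by under eq_fun do rewrite big_cons; exact: is_trigD.
Qed.

Lemma fhatD f g k : is_trig f -> is_trig g ->
  fhat (fun x => f x + g x) k = fhat f k + fhat g k.
Proof.
move=> [s fs] [t gt]; rewrite (fhat_tp _ fs) (fhat_tp _ gt) (@fhat_tp _ (s ++ t)).
  by rewrite /coef big_cat.
by move=> x; rewrite tp_cat real_complexD fs gt.
Qed.

Lemma fhatZ (r : R) f k : is_trig f -> fhat (fun x => r * f x) k = r%:C * fhat f k.
Proof.
move=> [s fs]; rewrite (fhat_tp _ fs) (@fhat_tp _ (tp_scale r%:C s)).
  exact: coef_scale.
by move=> x; rewrite tp_scaleE real_complexM fs.
Qed.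

Lemma fhat0 k : fhat (fun=> 0) k = 0.
Proof.
rewrite (@fhat_tp _ [::]); first by rewrite /coef big_nil.
by move=> x; rewrite /tp big_nil.
Qed.

Lemma fhat_sum (I : Type) (r : seq I) (F : I -> R -> R) k : (forall i, is_trig (F i)) ->
  fhat (fun x => \sum_(i <- r) F i x) k = \sum_(i <- r) fhat (F i) k.
Proof.
move=> tF; elim: r => [|i r IH].
  by under eq_fun do rewrite big_nil; rewrite big_nil fhat0.
under eq_fun do rewrite big_cons.
by rewrite big_cons fhatD// ?IH//; exact: is_trig_sum.
Qed.

Lemma fhat_conj f k : is_trig f -> fhat f (- k) = (fhat f k)^*.
Proof.
move=> [s fs]; rewrite (fhat_tp k fs) (@fhat_tp _ (tp_conj s)).
  by rewrite coef_conj opprK.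
by move=> x; rewrite tp_conjE -fs conjc_real.
Qed.

Lemma is_trig_derive f : is_trig f ->
  [/\ forall x, is_derive x 1 f (f^`()%classic x), is_trig f^`()%classic &
      forall k, fhat f^`()%classic k = (k%:~R * freq)%:C * 'i%C * fhat f k].
Proof.
move=> [s fs].
have fE : f = fun x => complex.Re (tp a b s x) by apply/funext => x; rewrite -fs.
(* The imaginary part of the polynomial is identically 0, hence so is its derivative: the
   differentiated list again represents a real function. *)
have f0 : (fun x => complex.Im (tp a b s x)) = fun=> 0 by apply/funext => x; rewrite -fs.
have f'E x : (f^`()%classic x)%:C = tp a b (tp_derive a b s) x.
  have [r i] := is_derive_tp a b s x.
  rewrite derive1E [in LHS]fE (@derive_val _ _ _ _ _ _ _ r).
  have : complex.Im (tp a b (tp_derive a b s) x) = 0.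
    rewrite -(@derive_val _ _ _ _ _ _ _ i) f0.
    exact: (@derive_val _ _ _ _ _ _ _ (is_derive_cst _ _ _)).
  by case: (tp _ _) => u v /= ->.
split.
- move=> x; have [r _] := is_derive_tp a b s x.
  have -> : f^`()%classic x = complex.Re (tp a b (tp_derive a b s) x) by rewrite -f'E.
  by rewrite fE.
- by exists (tp_derive a b s).
- by move=> k; rewrite (fhat_tp _ f'E) (fhat_tp _ fs) coef_derive.
Qed.

(** Periodicity in the form that replaces integration by parts in the energy identity. *)
Lemma fhat_derive_mean0 f : is_trig f -> fhat f^`()%classic 0 = 0.
Proof. by move=> tf; have [_ _ ->] := is_trig_derive tf; rewrite mulr0z mul0r rmorph0 !mul0r. Qed.

Lemma trig_sumE N c x : trig_sum a b N c x = \sum_(k <- modes N) c k * mode k x.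
Proof.
rewrite /Defs.trig_sum /modes big_flatten /= big_map; apply: eq_bigr => n _.
by rewrite !big_cons big_nil addr0.
Qed.

Lemma sum_modes N c l : \sum_(k <- modes N) c k *+ (k == l) = if l \in modes N then c l else 0.
Proof.
exact/sum_mulrn_pred1/modes_uniq.
Qed.

Definition tp_of N c := [seq (c k, k) | k <- modes N].

Lemma tp_ofE N c x : trig_sum a b N c x = tp a b (tp_of N c) x.
Proof. by rewrite trig_sumE /tp big_map. Qed.

Lemma coef_of N c k : coef (tp_of N c) k = if k \in modes N then c k else 0.
Proof. by rewrite /coef big_map sum_modes. Qed.

(** [M] is the largest frequency in a representing list. Beyond it the Fourier partial sums are
    constant, so that limits of such sums can be evaluated. *)
Lemma is_trig_expand f : is_trig f -> exists M : nat,
  (forall k, (M < `|k|)%N -> fhat f k = 0) /\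
  (forall n x, (M <= n)%N -> (f x)%:C = fhat f 0 + trig_sum a b n (fhat f) x).
Proof.
move=> [s fs]; pose M := \max_(p <- s) `|p.2|%N.
have pM p : p \in s -> (`|p.2| <= M)%N by move=> ps; rewrite /M (big_rem p ps) leq_maxl.
exists M; split.
  move=> k kM; rewrite (fhat_tp _ fs) /coef big_seq big1// => p ps.
  by rewrite (_ : p.2 == k = false)//; apply/eqP => pk; have := pM p ps; rewrite pk leqNgt kM.
move=> n x Mn; rewrite fs trig_sumE -[fhat f 0]mulr1 -(mode0 a b x) -[RHS](big_cons _ _ _ _ predT (fun k => fhat f k * mode k x)).
under [RHS]eq_bigr do rewrite (fhat_tp _ fs) /coef mulr_suml.
rewrite exchange_big /= /tp big_seq [RHS]big_seq; apply: eq_bigr => p ps.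
under eq_bigr do rewrite mulrnAl eq_sym.
rewrite (sum_mulrn_pred1 (fun k => p.1 * mode k x)).
  rewrite inE mem_modes (leq_trans (pM p ps) Mn) andbT absz_gt0.
  by case: eqVneq.
by rewrite /= modes_uniq mem_modes.
Qed.

Lemma is_trig_ext f g : is_trig f -> is_trig g -> (forall k, fhat f k = fhat g k) -> f = g.
Proof.
move=> /is_trig_expand[M [_ fM]] /is_trig_expand[M' [_ gM']] fg; apply/funext => x.
have : (f x)%:C = (g x)%:C.
  rewrite (fM _ _ (leq_maxl M M')) (gM' _ _ (leq_maxr M M')).
  by rewrite fg (_ : fhat f = fhat g)//; exact/funext.
by move=> [].
Qed.

(* Conjugate symmetry of the coefficients makes the sum real. *)
Lemma Re_trig_sum (c0 : R) N c : (forall k, c (- k) = (c k)^*) ->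
  let f x := complex.Re (c0%:C + trig_sum a b N c x) in
  [/\ forall x, (f x)%:C = c0%:C + trig_sum a b N c x, is_trig f &
      forall k, fhat f k = if k == 0 then c0%:C else if (`|k| <= N)%N then c k else 0].
Proof.
move=> cN f; pose s := (c0%:C, 0 : int) :: tp_of N c.
have sE x : tp a b s x = c0%:C + trig_sum a b N c x.
  by rewrite tp_ofE /tp big_cons mode0 mulr1.
have fs x : (f x)%:C = tp a b s x.
  rewrite sE; apply: RRe_real; apply: rpredD; first exact/complex_realP/ex_intro.
  apply: rpred_sum => n _; rewrite modeN cN.
  have -> : (c n)^* * (mode n x)^* = (c n * mode n x)^* by rewrite rmorphM.
  by rewrite addcJ; apply: rpredM; [exact: realn|apply/complex_realP; eexists].
split; [by move=> x; rewrite fs sE|by exists s|].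
move=> k; rewrite (fhat_tp _ fs) /coef big_cons -/(coef _ k) coef_of mem_modes /=.
rewrite eq_sym; case: eqVneq => [->|k0]; first by rewrite mulr1n addr0.
by rewrite mulr0n add0r absz_gt0 k0.
Qed.

End RealTrigonometricPolynomials.

(** * The Galerkin vector field *)

Section GalerkinVectorField.
Local Open Scope complex_scope.
Context {R : realType} (a b : R).
Hypothesis ab : a < b.
Local Notation freq := (freq a b).
Local Notation fhat := (fhat a b).
Local Notation is_trig := (is_trig a b).
Local Notation SN := (SN a b).
Local Notation PN := (PN a b).
Local Notation Lam := (Lam a b).
Implicit Types (f g V : R -> R) (k l : int) (N : nat) (x : R).

Lemma SN_trigP N f : SN N f <-> is_trig f /\ forall k, k \notin modes N -> fhat f k = 0.
Proof.
split=> [[c fc]|[tf f0]].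
  have fE x : (f x)%:C = tp a b (tp_of N c) x by rewrite fc tp_ofE.
  split; first by exists (tp_of N c).
  by move=> k kN; rewrite (fhat_tp ab _ fE) coef_of (negbTE kN).
have fN k : fhat f (- k) = (fhat f k)^* by exact: fhat_conj.
have [gE tg g_hat] := Re_trig_sum ab 0 N fN.
exists (fhat f) => x; rewrite -[RHS]add0r -[0 in RHS]/(0%:C) -gE; congr (_ %:C).
move: x; apply/funeqP; apply: (is_trig_ext ab) => // k; rewrite g_hat.
have [->|k0] := eqVneq k 0; first by rewrite f0// mem_modes.
by case: ifP => // kN; rewrite f0// mem_modes absz_gt0 k0 kN.
Qed.

Lemma SN_is_trig N f : SN N f -> is_trig f.
Proof. by move=> /SN_trigP[]. Qed.

Lemma memNmodes N k : (- k \in modes N) = (k \in modes N).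
Proof. by rewrite !mem_modes abszN. Qed.

Lemma PN_SN N f : SN N (PN N f).
Proof.
have PE : PN N f = fun x => complex.Re (tp a b (tp_of N (fhat f)) x).
  by apply/funext => x; rewrite /Defs.PN tp_ofE.
apply/SN_trigP; rewrite PE; split; first exact: is_trig_Re.
move=> k kN; rewrite (fhat_Re ab) !coef_of memNmodes (negbTE kN). by rewrite rmorph0 addr0 mulr0.
Qed.

Lemma fhat_PN N f k : is_trig f -> fhat (PN N f) k = if k \in modes N then fhat f k else 0.
Proof.
move=> tf.
have -> : PN N f = fun x => complex.Re (tp a b (tp_of N (fhat f)) x).
  by apply/funext => x; rewrite /Defs.PN tp_ofE.
rewrite (fhat_Re ab) !coef_of memNmodes; case: ifP => _; last by rewrite rmorph0 addr0 mulr0.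
(* Taking [Re] in [PN] averages [fhat f k] with the conjugate of [fhat f (- k)]; for real [f] these
   two coincide. *)
rewrite (fhat_conj ab)// conjcK; by field.
Qed.

Lemma SND N f g : SN N f -> SN N g -> SN N (fun x => f x + g x).
Proof.
move=> /SN_trigP[tf f0] /SN_trigP[tg g0]; apply/SN_trigP; split; first exact: is_trigD.
by move=> k kN; rewrite fhatD// f0// g0// addr0.
Qed.

Lemma SNZ N (r : R) f : SN N f -> SN N (fun x => r * f x).
Proof.
move=> /SN_trigP[tf f0]; apply/SN_trigP; split; first exact: is_trigZ.
by move=> k kN; rewrite fhatZ// f0// mulr0.
Qed.

Lemma SN_sum N (I : Type) (r : seq I) (F : I -> R -> R) :
  (forall i, SN N (F i)) -> SN N (fun x => \sum_(i <- r) F i x).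
Proof.
move=> SF; have tF i : is_trig (F i) by exact: SN_is_trig (SF i).
apply/SN_trigP; split; first exact: is_trig_sum.
move=> k kN; rewrite fhat_sum// big1// => i _.
by have /SN_trigP[_ ->] := SF i.
Qed.

Lemma SN_derive N f : SN N f -> SN N f^`()%classic.
Proof.
move=> /SN_trigP[tf f0]; have [_ tf' f'E] := is_trig_derive ab tf.
by apply/SN_trigP; split => // k kN; rewrite f'E f0// mulr0.
Qed.

(** The convolution theorem, summed over the frequencies of [g] only, which are confined to
    [modes N]; [f] may have any degree. *)
Lemma fhatM N f g k : is_trig f -> SN N g ->
  fhat (fun x => f x * g x) k = \sum_(l <- modes N) fhat g l * fhat f (k - l).
Proof.
move=> [s fs] [c gc].
have gE x : (g x)%:C = tp a b (tp_of N c) x by rewrite gc tp_ofE.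
rewrite (@fhat_tp _ _ _ ab _ (tp_mul s (tp_of N c))); last first.
  by move=> x; rewrite tp_mulE real_complexM fs gE.
rewrite coef_mul exchange_big /= big_map big_seq [RHS]big_seq.
apply: eq_bigr => l lN.
rewrite (fhat_tp ab _ gE) (fhat_tp ab _ fs) coef_of lN /coef mulr_sumr.
by apply: eq_bigr => p _ /=; rewrite mulrnAr mulrC eq_sym -subr_eq eq_sym.
Qed.

(** The series defining [Lam f] is stationary from the degree of [f] on, and the multiplier is real
    and even, so conjugate symmetry of the coefficients survives and the sum stays real. *)
Lemma is_trig_Lam f : is_trig f -> is_trig (Lam f) /\
  forall k, fhat (Lam f) k = ((1 + (k%:~R * freq) ^+ 2)^-1)%:C * fhat f k.
Proof.
move=> tf; have [M [f0 _]] := is_trig_expand ab tf.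
pose c k := ((1 + (k%:~R * freq) ^+ 2)^-1)%:C * fhat f k.
have cN k : c (- k) = (c k)^*.
  by rewrite /c (fhat_conj ab)// mulrNz mulNr sqrrN; case: (fhat f k) => u v; simpc.
have c0 k : (M < `|k|)%N -> c k = 0 by move=> kM; rewrite /c f0// mulr0.
have c0E : c 0 = (complex.Re (c 0))%:C.
  by move: (cN 0); rewrite oppr0; case: (c 0) => u v [] /= v0; congr (_ +i* _); lra.
have sE n x : (M <= n)%N -> trig_sum a b n c x = trig_sum a b M c x.
  move=> Mn; rewrite /trig_sum (@big_cat_nat _ _ _ M.+1)//= [X in _ + X]big_nat [X in _ + X]big1 ?addr0//.
  by move=> i /andP[Mi _]; rewrite !c0 ?abszN// !mul0r addr0.
have LE : Lam f = fun x => complex.Re ((complex.Re (c 0))%:C + trig_sum a b M c x).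
  apply/funext => x; rewrite -c0E; apply: cvg_lim => //.
  apply: cvg_near_cst; near=> n; rewrite -/(c 0) sE//.
  by near: n; exact: nbhs_infty_ge.
have [_ tL LhE] := Re_trig_sum ab (complex.Re (c 0)) M cN.
rewrite LE; split => // k; rewrite LhE -c0E.
by case: eqVneq => [->//|k0]; rewrite -/(c k); case: leqP => // /c0.
Unshelve. all: end_near. Qed.

(** Real coordinates on S_N: the boolean selects real or imaginary part, and the index is shifted by
    one so that the frequencies run from 1 to [N]. *)
Definition coord N (p : 'I_N * bool) f : R :=
  if p.2 then complex.Re (fhat f p.1.+1) else complex.Im (fhat f p.1.+1).

(** The factor 2 counts the conjugate coefficient at the opposite frequency. *)
Definition coord_weight N (p : 'I_N * bool) : R := 2 * (1 + (p.1.+1%:R * freq) ^+ 2).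

Lemma coordTE N (n : 'I_N) f : coord (n, true) f = complex.Re (fhat f n.+1).
Proof. by []. Qed.

Lemma coordFE N (n : 'I_N) f : coord (n, false) f = complex.Im (fhat f n.+1).
Proof. by []. Qed.

Lemma coord_weightE N (p : 'I_N * bool) :
  coord_weight p = 2 * (1 + ((p.1.+1 : int)%:~R * freq) ^+ 2).
Proof. by []. Qed.

Definition H1dot N f g : R :=
  \sum_(p : 'I_N * bool) coord_weight p * (coord p f * coord p g).

Lemma coord_weight_ge0 N (p : 'I_N * bool) : 0 <= coord_weight p.
Proof. by rewrite /coord_weight mulr_ge0// addr_ge0// sqr_ge0. Qed.

Lemma sum_modes_pair N (V : nmodType) (F : int -> V) :
  \sum_(k <- modes N) F k = \sum_(n < N) (F n.+1 + F (- n.+1%:Z)).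
Proof.
rewrite /modes big_flatten /= big_map big_add1 /= big_mkord.
by apply: eq_bigr => n _; rewrite !big_cons big_nil addr0.
Qed.

Lemma sum_coord N (F : 'I_N * bool -> R) :
  \sum_(p : 'I_N * bool) F p = \sum_(n < N) (F (n, true) + F (n, false)).
Proof.
rewrite (eq_bigr (fun p => F (p.1, p.2))); last by case.
rewrite -(pair_bigA _ (fun n c => F (n, c))) /=.
by apply: eq_bigr => n _; rewrite big_bool.
Qed.

Lemma Hnorm2_SN N f : SN N f -> Hnorm2 a b 1 f = (H1dot N f f)%:E.
Proof.
move=> /SN_trigP[tf f0]; rewrite /Hnorm2.
set F := fun k : int => _.
have F0 k : (0 <= F k)%E.
  by rewrite /F lee_fin mulr_ge0 ?powR_ge0// /csqnorm addr_ge0 ?sqr_ge0.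
rewrite (_ : esum _ _ = \esum_(k in [set` modes N]) F k)%E; last first.
  rewrite [RHS]esum_mkcond; apply: eq_esum => k _.
  rewrite mem_setE /in_mem /=; case: ifPn => // kN.
  by rewrite /F f0// /csqnorm /= expr0n /= addr0 mulr0.
rewrite esum_fset//; last exact: finite_seq.
rewrite -fsbig_seq ?modes_uniq// sumEFin; congr (_%:E).
rewrite sum_modes_pair /H1dot sum_coord; apply: eq_bigr => n _.
rewrite /F coordTE coordFE (coord_weightE (n, true)) (coord_weightE (n, false)) /csqnorm.
rewrite fhat_conj// mulrNz mulNr normrN.
rewrite !powRr1 ?addr_ge0 ?sqr_ge0// real_normK ?num_real//.
by case: (fhat f _) => u v /=; ring.
Qed.

Lemma coordD N (p : 'I_N * bool) f g : is_trig f -> is_trig g ->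
  coord p (fun x => f x + g x) = coord p f + coord p g.
Proof.
by move=> tf tg; rewrite /coord fhatD//; case: (fhat f _) (fhat g _) => [? ?] [? ?]; case: p.2.
Qed.

Lemma coordZ N (p : 'I_N * bool) (r : R) f : is_trig f ->
  coord p (fun x => r * f x) = r * coord p f.
Proof. by move=> tf; rewrite /coord fhatZ//; case: (fhat f _) => ? ?; case: p.2; simpc. Qed.

Lemma coord_sum N (p : 'I_N * bool) (I : Type) (r : seq I) (F : I -> R -> R) :
  (forall i, is_trig (F i)) ->
  coord p (fun x => \sum_(i <- r) F i x) = \sum_(i <- r) coord p (F i).
Proof.
move=> tF; elim: r => [|i r IH].
  under eq_fun do rewrite big_nil.
  by rewrite big_nil /coord fhat0//; case: p.2.
under eq_fun do rewrite big_cons.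
by rewrite big_cons coordD// ?IH//; exact: is_trig_sum.
Qed.

(* Parseval, with the weights [1 + (k freq)^2] absorbed in [V - V'']. *)
Lemma H1dot_mean N h V : is_trig h -> SN N V ->
  H1dot N (PN N h) V = complex.Re (fhat (fun x => h x * (V x - V^`()^`()%classic x)) 0).
Proof.
move=> th SV; have tV := SN_is_trig SV.
have [_ tV1 V1E] := is_trig_derive ab tV.
have [_ tV2 V2E] := is_trig_derive ab tV1.
have SV2 := SNZ (-1) (SN_derive (SN_derive SV)).
have vE : (fun x => V x - V^`()^`()%classic x) = fun x => V x + (-1) * V^`()^`()%classic x.
  by apply/funext => x; rewrite mulN1r.
rewrite (@fhatM N _ (fun x => V x - V^`()^`()%classic x))//; last first.
  by rewrite vE; exact: SND.
rewrite sum_modes_pair raddf_sum /H1dot sum_coord; apply: eq_bigr => n _.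
have nN : (n.+1%:Z \in modes N) by rewrite mem_modes ltn_ord.
have vhE k : fhat (fun x => V x + (-1) * V^`()^`()%classic x) k =
    (1 + (k%:~R * freq) ^+ 2)%:C * fhat V k.
  rewrite fhatD//; last exact: is_trigZ.
  rewrite fhatZ// V2E V1E; move: (fhat V k) => [u v]; simpc; congr (_ +i* _); ring.
rewrite !coordTE !coordFE (coord_weightE (n, true)) (coord_weightE (n, false)).
rewrite fhat_PN// nN vE !vhE !sub0r opprK !(fhat_conj ab)// mulrNz mulNr sqrrN.
move: (fhat V _) (fhat h _) => [u v] [u' v'] /=.
by set w := _ ^+ 2; simpc => /=; rewrite /w; ring.
Qed.

Let Lsource V x := V x ^+ 2 + 2^-1 * V^`()%classic x ^+ 2.

Let flux V x := 2^-1 * (fun z => V z ^+ 2)^`()%classic x + (Lam (Lsource V))^`()%classic x.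

Let FNE N V : FN a b N V = fun x => -1 * PN N (flux V) x.
Proof. by apply/funext => x; rewrite mulN1r. Qed.

Let is_trig_Lsource V : is_trig V -> is_trig (Lsource V).
Proof.
move=> tV; have [_ tV' _] := is_trig_derive ab tV.
by apply: is_trigD; [exact: is_trig_sqr|apply: is_trigZ; exact: is_trig_sqr].
Qed.

Let is_trig_flux V : is_trig V -> is_trig (flux V).
Proof.
move=> tV; have [_ t1 _] := is_trig_derive ab (is_trig_sqr tV).
have [tL _] := is_trig_Lam (is_trig_Lsource tV).
by have [_ t2 _] := is_trig_derive ab tL; apply: is_trigD => //; exact: is_trigZ.
Qed.

Lemma FN_SN N V : SN N (FN a b N V).
Proof. by rewrite FNE; apply: SNZ; exact: PN_SN. Qed.

(** Serves measurability: products become finite convolutions, so every coefficient of [FN V] is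
    visibly a polynomial in the coefficients of [V]. *)
Lemma fhat_FN N V k : SN N V -> fhat (FN a b N V) k =
  if k \in modes N then
    let conv c := \sum_(l <- modes N) c l * c (k - l) in
    let V2 := conv (fhat V) in
    let Vx2 := conv (fun l => (l%:~R * freq)%:C * 'i%C * fhat V l) in
    - ((2^-1)%:C * ((k%:~R * freq)%:C * 'i%C * V2) +
       (k%:~R * freq)%:C * 'i%C *
         (((1 + (k%:~R * freq) ^+ 2)^-1)%:C * (V2 + (2^-1)%:C * Vx2)))
  else 0.
Proof.
move=> SV; have tV := SN_is_trig SV.
have [_ tV1 V1E] := is_trig_derive ab tV; have SV1 := SN_derive SV.
have [_ tVV' VV'E] := is_trig_derive ab (is_trig_sqr tV).
have tS := is_trig_Lsource tV; have [tL LE] := is_trig_Lam tS.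
have [_ tL' L'E] := is_trig_derive ab tL.
have tP : is_trig (PN N (flux V)) := SN_is_trig (PN_SN N (flux V)).
rewrite FNE fhatZ// fhat_PN; last exact: is_trig_flux.
case: ifP => kN; last by rewrite mulr0.
rewrite [in LHS]/flux fhatD//; last exact: is_trigZ.
rewrite fhatZ// VV'E L'E LE [in LHS]/Lsource fhatD//; last 2 first.
- exact: is_trig_sqr.
- by apply: is_trigZ; exact: is_trig_sqr.
rewrite fhatZ; [|exact: ab|exact: is_trig_sqr].
have sqrE f : (fun x => f x ^+ 2) = fun x => f x * f x.
  by apply/funext => x; rewrite expr2.
rewrite !sqrE (fhatM _ tV SV) (fhatM _ tV1 SV1).
have -> : \sum_(l <- modes N) fhat V^`()%classic l * fhat V^`()%classic (k - l) =
    \sum_(l <- modes N) (l%:~R * freq)%:C * 'i%C * fhat V l *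
      (((k - l)%:~R * freq)%:C * 'i%C * fhat V (k - l)).
  by apply: eq_bigr => l _; rewrite !V1E.
by rewrite rmorphN1 mulN1r.
Qed.

(* With [w := Lam g], [g = V^2 + (V')^2 / 2 = w - w''], one has
   [(V V' + w') (V - V'') = (V w - V' w' - V (V')^2 / 2)']. *)
Lemma FN_energy N V : SN N V -> H1dot N (FN a b N V) V = 0.
Proof.
move=> SV; have tV := SN_is_trig SV.
have [dV tV1 V1E] := is_trig_derive ab tV.
have [dV1 tV2 _] := is_trig_derive ab tV1.
have tS := is_trig_Lsource tV; have [tw wE] := is_trig_Lam tS.
set w := Lam (Lsource V) in tw wE *.
have [dw tw1 w1E] := is_trig_derive ab tw.
have [dw1 tw2 w2E] := is_trig_derive ab tw1.
have gE : Lsource V = fun x => w x + -1 * w^`()^`()%classic x.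
  apply: (is_trig_ext ab) => //; first by apply: is_trigD => //; exact: is_trigZ.
  move=> k; rewrite fhatD//; last exact: is_trigZ.
  rewrite fhatZ// w2E w1E wE.
  have q0 : 1 + (k%:~R * freq) ^+ 2 != 0 by rewrite gt_eqF// ltr_wpDr ?sqr_ge0.
  move: (fhat _ k) => [u v]; simpc; congr (_ +i* _); by field.
pose E x := V x * w x + -1 * (V^`()%classic x * w^`()%classic x) +
  - 2^-1 * (V x * (V^`()%classic x) ^+ 2).
have tE : is_trig E.
  apply: is_trigD; first apply: is_trigD.
  - exact: is_trigM.
  - by apply: is_trigZ; exact: is_trigM.
  - by apply: is_trigZ; apply: is_trigM => //; exact: is_trig_sqr.
have E'E : (fun x => flux V x * (V x - V^`()^`()%classic x)) = E^`()%classic.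
  apply/funext => x; have := congr1 (@^~ x) gE; rewrite /Lsource => gx.
  have := dV x; have := dV1 x; have := dw x; have := dw1 x => dw1x dwx dV1x dVx.
  have VVE : (fun z => V z ^+ 2)^`()%classic x = 2 * V x * V^`()%classic x.
    rewrite derive1E; apply: derive_val; apply: is_derive_eq; rewrite /GRing.scale /=; ring.
  have -> : E^`()%classic x = V^`()%classic x * w x + V x * w^`()%classic x
     - V^`()^`()%classic x * w^`()%classic x - V^`()%classic x * w^`()^`()%classic x
     - 2^-1 * (V^`()%classic x) ^+ 3 - V x * V^`()%classic x * V^`()^`()%classic x.
    have d1 : is_derive x 1 (fun y => V y * w y)
        (V x * w^`()%classic x + w x * V^`()%classic x) := is_deriveM dVx dwx.
    have d2 : is_derive x 1 (fun y => V^`()%classic y * w^`()%classic y)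
        (V^`()%classic x * w^`()^`()%classic x + w^`()%classic x * V^`()^`()%classic x).
      exact: is_deriveM dV1x dw1x.
    have d3 : is_derive x 1 (fun y => V^`()%classic y ^+ 2)
        (2 * V^`()%classic x * V^`()^`()%classic x).
      by apply: is_derive_eq; rewrite /GRing.scale /=; ring.
    have d4 : is_derive x 1 (fun y => V y * V^`()%classic y ^+ 2)
        (V x * (2 * V^`()%classic x * V^`()^`()%classic x) +
         V^`()%classic x ^+ 2 * V^`()%classic x) := is_deriveM dVx d3.
    rewrite derive1E.
    rewrite (@derive_val _ _ _ _ _ _ _ (is_deriveD (is_deriveD d1 (is_deriveZ (-1) d2)) (is_deriveZ (- 2^-1) d4))).
    rewrite /GRing.scale /=.
    move: (V x) (V^`()%classic x) (V^`()^`()%classic x) => v v1 v2.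
    move: (w x) (w^`()%classic x) (w^`()^`()%classic x) => u u1 u2.
    by field.
  (* Eliminating the second derivative of [w] through [w - w'' = g] leaves a polynomial identity in
     [V], [V'], [V''], [w] and [w']. *)
  have w2x : w^`()^`()%classic x = w x - (V x ^+ 2 + 2^-1 * V^`()%classic x ^+ 2).
    by rewrite gx mulN1r; ring.
  rewrite /flux -/w VVE w2x; by field.
have -> : H1dot N (FN a b N V) V = - H1dot N (PN N (flux V)) V.
  rewrite /H1dot -sumrN; apply: eq_bigr => p _.
  by rewrite FNE coordZ ?mulN1r ?mulNr ?mulrN//; exact: SN_is_trig (PN_SN N _).
rewrite H1dot_mean//; last exact: is_trig_flux.
by rewrite E'E fhat_derive_mean0// oppr0.
Qed.

End GalerkinVectorField.

(** * Measurability of Fourier coefficients *)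

Section ComplexMeasurable.
Context {R : realType} {d : measure_display} {T : measurableType d}.
Implicit Types (X Y : T -> R[i]).
Local Open Scope complex_scope.

Definition cmeasurable X :=
  measurable_fun setT (fun w => complex.Re (X w)) /\
  measurable_fun setT (fun w => complex.Im (X w)).

Lemma cmeasurable_cst (z : R[i]) : cmeasurable (fun=> z).
Proof. by split; exact: measurable_cst. Qed.

Lemma cmeasurableD X Y : cmeasurable X -> cmeasurable Y -> cmeasurable (fun w => X w + Y w).
Proof.
move=> [rX iX] [rY iY]; split.
- rewrite (_ : (fun w => _) = fun w => complex.Re (X w) + complex.Re (Y w)); first exact: measurable_funD.
  by apply/funext => w; case: (X w) (Y w) => [? ?] [? ?].
- rewrite (_ : (fun w => _) = fun w => complex.Im (X w) + complex.Im (Y w)); first exact: measurable_funD.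
  by apply/funext => w; case: (X w) (Y w) => [? ?] [? ?].
Qed.

Lemma cmeasurableM X Y : cmeasurable X -> cmeasurable Y -> cmeasurable (fun w => X w * Y w).
Proof.
move=> [rX iX] [rY iY]; split.
- rewrite (_ : (fun w => _) = fun w => complex.Re (X w) * complex.Re (Y w) -
      complex.Im (X w) * complex.Im (Y w)).
    by apply: measurable_funB; exact: measurable_funM.
  by apply/funext => w; case: (X w) (Y w) => [? ?] [? ?].
- rewrite (_ : (fun w => _) = fun w => complex.Re (X w) * complex.Im (Y w) +
      complex.Im (X w) * complex.Re (Y w)).
    by apply: measurable_funD; exact: measurable_funM.
  by apply/funext => w; case: (X w) (Y w) => [? ?] [? ?].
Qed.

Lemma cmeasurableN X : cmeasurable X -> cmeasurable (fun w => - X w).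
Proof.
move=> mX; under eq_fun do rewrite -mulN1r.
by apply: cmeasurableM => //; exact: cmeasurable_cst.
Qed.

Lemma cmeasurable_sum (I : Type) (r : seq I) (X : I -> T -> R[i]) :
  (forall i, cmeasurable (X i)) -> cmeasurable (fun w => \sum_(i <- r) X i w).
Proof.
move=> mX; elim: r => [|i r IH].
  by under eq_fun do rewrite big_nil; exact: cmeasurable_cst.
by under eq_fun do rewrite big_cons; exact: cmeasurableD.
Qed.

Lemma cmeasurable_fhat_FN (a b : R) (ab : a < b) (N : nat) (V : T -> R -> R) (k : int) :
  (forall w, SN a b N (V w)) -> (forall l, cmeasurable (fun w => fhat a b (V w) l)) ->
  cmeasurable (fun w => fhat a b (FN a b N (V w)) k).
Proof.
move=> SV mV; rewrite (funext (fun w => fhat_FN ab k (SV w))) /=.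
case: (k \in modes N); last exact: cmeasurable_cst.
have mconv (c : T -> int -> R[i]) : (forall l, cmeasurable (c ^~ l)) ->
    cmeasurable (fun w => \sum_(l <- modes N) c w l * c w (k - l)).
  by move=> mc; apply: cmeasurable_sum => l; exact: cmeasurableM.
have mZ (z : R[i]) X : cmeasurable X -> cmeasurable (fun w => z * X w).
  by move=> mX; apply: cmeasurableM => //; exact: cmeasurable_cst.
apply: cmeasurableN; apply: cmeasurableD; first by do 2 apply: (mZ); exact: mconv.
do 2 apply: (mZ); apply: cmeasurableD; first exact: mconv.
by apply: (mZ); apply: (mconv (fun w l => _)) => l; exact: mZ.
Qed.

End ComplexMeasurable.

Section SubSigmaAlgebra.
Context {R : realType} {d : measure_display} {Omega : measurableType d}.

(** Viewing [Fs] as the sigma-algebra of a measurable type makes the closure properties of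
    measurable functions available for it; generation adds no set because [Fs] is already a
    sigma-algebra. *)
Lemma measurable_wrtP (Fs : set (set Omega)) (X : Omega -> R) :
  sigma_algebra [set: Omega] Fs ->
  measurable_wrt Fs X <-> measurable_fun [set: g_sigma_algebraType Fs] (X : g_sigma_algebraType Fs -> R).
Proof.
move=> sF; split => [mX _ B mB|mX B mB].
  by rewrite setTI; apply: sub_sigma_algebra; exact: mX.
have := mX measurableT _ mB; rewrite setTI => h.
by have : <<s Fs >> (X @^-1` B) := h; rewrite sigma_algebra_id.
Qed.

Lemma measurable_wrt_measurable (Fs : set (set Omega)) (X : Omega -> R) :
  Fs `<=` measurable -> measurable_wrt Fs X -> measurable_fun setT X.
Proof. by move=> sF mX _ B mB; rewrite setTI; apply: sF; exact: mX. Qed.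

End SubSigmaAlgebra.

(** * Quadratic invariants of symplectic Runge-Kutta methods *)

Section RungeKutta.
Context {R : realType}.

(** With [M i j] the weighted product of [f i] and [f j], the stage equation and orthogonality of
    [f i] to [v i] express the product of [f i] and [u] as [- tau * sum_j A i j * M i j]. The term
    linear in the increment and its square then become opposite multiples of
    [sum_ij b_i * A i j * M i j]. *)
Lemma symplectic_RK_quadratic (I : finType) (wt : I -> R) (s : nat) (A : 'M[R]_s)
    (bw : 'rV[R]_s) (tau : R) (u : I -> R) (f v : 'I_s -> I -> R) :
  (forall i j, bw ord0 i * A i j + bw ord0 j * A j i = bw ord0 i * bw ord0 j) ->
  (forall i p, v i p = u p + tau * \sum_(j < s) A i j * f j p) ->
  (forall i, \sum_p wt p * (f i p * v i p) = 0) ->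
  \sum_p wt p * (u p + tau * \sum_(i < s) bw ord0 i * f i p) ^+ 2 =
  \sum_p wt p * u p ^+ 2.
Proof.
move=> sympl vE fv0.
pose M i j := \sum_p wt p * (f i p * f j p).
have MC i j : M i j = M j i by apply: eq_bigr => p _; rewrite [f i p * _]mulrC.
have fu i : \sum_p wt p * (f i p * u p) = - tau * \sum_(j < s) A i j * M i j.
  have E : tau * (\sum_(j < s) A i j * M i j) =
      \sum_p wt p * (f i p * (tau * \sum_(j < s) A i j * f j p)).
    under [RHS]eq_bigr do rewrite 3!mulr_sumr.
    rewrite exchange_big mulr_sumr; apply: eq_bigr => j _.
    by rewrite /M 2!mulr_sumr; apply: eq_bigr => p _; ring.
  apply/eqP; rewrite mulNr -addr_eq0 E -big_split /=; apply/eqP; rewrite -[RHS](fv0 i).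
  by apply: eq_bigr => p _; rewrite vE; ring.
pose g p := \sum_(i < s) bw ord0 i * f i p.
have ug : \sum_p wt p * (u p * g p) = - tau * \sum_(i < s) \sum_(j < s) bw ord0 i * A i j * M i j.
  transitivity (\sum_(i < s) bw ord0 i * \sum_p wt p * (f i p * u p)).
    under [RHS]eq_bigr do rewrite mulr_sumr.
    rewrite exchange_big; apply: eq_bigr => p _; rewrite /g 2!mulr_sumr.
    by apply: eq_bigr => i _; ring.
  rewrite mulr_sumr; apply: eq_bigr => i _; rewrite fu mulrCA; congr (_ * _).
  by rewrite mulr_sumr; apply: eq_bigr => j _; rewrite mulrA.
have gg : \sum_p wt p * g p ^+ 2 = 2 * \sum_(i < s) \sum_(j < s) bw ord0 i * A i j * M i j.
  transitivity (\sum_(i < s) \sum_(j < s) bw ord0 i * bw ord0 j * M i j).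
    under [RHS]eq_bigr do under eq_bigr do rewrite mulr_sumr.
    under [RHS]eq_bigr do rewrite exchange_big.
    rewrite exchange_big; apply: eq_bigr => p _.
    rewrite expr2 /g big_distrlr mulr_sumr /=; apply: eq_bigr => i _.
    by rewrite mulr_sumr; apply: eq_bigr => j _; ring.
  (* Swapping the indices in one of two copies of the double sum, [M] being symmetric, produces
     exactly [b_i * A i j + b_j * A j i]. *)
  rewrite mulr2n mulrDl mul1r [X in _ + X]exchange_big -big_split.
  apply: eq_bigr => i _; rewrite -big_split; apply: eq_bigr => j _ /=.
  by rewrite -sympl mulrDl (MC j i).
transitivity (\sum_p wt p * u p ^+ 2 +
    (2 * tau * (\sum_p wt p * (u p * g p)) + tau ^+ 2 * (\sum_p wt p * g p ^+ 2))).
  rewrite !mulr_sumr -!big_split; apply: eq_bigr => p _ /=.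
  by rewrite -/(g p); ring.
by rewrite ug gg; ring.
Qed.

End RungeKutta.

(** * Wiener increments *)

Section TorusL2.
Local Open Scope complex_scope.
Context {R : realType} (a b : R).
Hypothesis ab : a < b.
Local Notation mu := (@lebesgue_measure R).
Local Notation torus := (torus a b).
Local Notation fhat := (fhat a b).
Local Notation L20 := (L20 a b).
Local Notation inner := (inner a b).
Implicit Types f g : R -> R.

Let mtorus : measurable (torus : set (measurableTypeR R)).
Proof. exact: measurable_itv. Qed.

Let integrable_le f g : measurable_fun torus f -> (forall x, `|f x| <= g x) ->
  mu.-integrable torus (EFin \o g) -> mu.-integrable torus (EFin \o f).
Proof.
move=> mf fg ig; apply: (le_integrable mtorus _ _ ig).
  exact/measurable_EFinP.
by move=> x _; rewrite /= lee_fin (le_trans (fg x))// ler_norm.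
Qed.

Let integrableD_EFin f g : mu.-integrable torus (EFin \o f) ->
  mu.-integrable torus (EFin \o g) -> mu.-integrable torus (EFin \o (fun x => f x + g x)).
Proof. exact: integrableD. Qed.

Let integrableZ_EFin (c : R) f : mu.-integrable torus (EFin \o f) ->
  mu.-integrable torus (EFin \o (fun x => c * f x)).
Proof. exact: integrableZl. Qed.

Lemma L2_integrableM f g : L2 a b f -> L2 a b g ->
  mu.-integrable torus (EFin \o (fun x => f x * g x)).
Proof.
move=> [mf f2] [mg g2]; apply: (@integrable_le _ (fun x => f x ^+ 2 + g x ^+ 2)).
- exact: measurable_funM.
- move=> x; rewrite ler_norml; apply/andP; split.
    by have := sqr_ge0 (f x + g x); have := sqr_ge0 (f x); have := sqr_ge0 (g x); nra.
  by have := sqr_ge0 (f x - g x); have := sqr_ge0 (f x); have := sqr_ge0 (g x); nra.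
- exact: integrableD_EFin.
Qed.

Let integrable_cst (c : R) : mu.-integrable torus (EFin \o (fun=> c)).
Proof. by apply: integrable_torus => x; exact: cvg_cst. Qed.

Lemma L2_integrable f : L2 a b f -> mu.-integrable torus (EFin \o f).
Proof.
move=> [mf f2]; apply: (@integrable_le _ (fun x => f x ^+ 2 + 1)) => //.
  move=> x; rewrite ler_norml; apply/andP; split.
    by have := sqr_ge0 (f x + 1); have := sqr_ge0 (f x); nra.
  by have := sqr_ge0 (f x - 1); have := sqr_ge0 (f x); nra.
by apply: integrableD_EFin => //; exact: integrable_cst.
Qed.

Lemma inner_linear (c : R) f g : L2 a b f -> L2 a b g ->
  inner (fun x => c * f x + g x) (fun x => c * f x + g x) =
  c ^+ 2 * inner f f + 2 * c * inner f g + inner g g.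
Proof.
move=> Lf Lg; rewrite /Defs.inner.
have i1 := L2_integrableM Lf Lf; have i2 := L2_integrableM Lf Lg.
have i3 := L2_integrableM Lg Lg.
have -> : \int[mu]_(x in torus) ((c * f x + g x) * (c * f x + g x)) =
   \int[mu]_(x in torus) ((c ^+ 2 * (f x * f x) + 2 * c * (f x * g x)) + g x * g x).
  by apply: eq_Rintegral => x _; ring.
rewrite (RintegralD mtorus (integrableD_EFin (integrableZ_EFin (c ^+ 2) i1)
  (integrableZ_EFin (2 * c) i2)) i3).
rewrite (RintegralD mtorus (integrableZ_EFin (c ^+ 2) i1) (integrableZ_EFin (2 * c) i2)).
rewrite (RintegralZl _ mtorus i1) (RintegralZl _ mtorus i2); ring.
Qed.

Lemma L20_linear (c : R) f g : L20 f -> L20 g -> L20 (fun x => c * f x + g x).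
Proof.
move=> [Lf f0] [Lg g0]; split.
  split.
    apply: measurable_funD; last by case: Lg.
    by apply: measurable_funM => //; case: Lf.
  rewrite (_ : _ \o _ = EFin \o (fun x => (c ^+ 2 * (f x * f x) + 2 * c * (f x * g x)) + g x * g x)).
    apply: integrableD_EFin; last exact: L2_integrableM.
    by apply: integrableD_EFin; apply: integrableZ_EFin; exact: L2_integrableM.
  by apply/funext => x /=; congr EFin; ring.
have modeE h : (fun x => (h x)%:C * mode a b (- 0) x) = fun x => (h x)%:C.
  by apply/funext => x; rewrite oppr0 mode0 mulr1.
have ci h : L2 a b h -> cintegrable a b (fun x => (h x)%:C).
  by move=> Lh; split; [exact: L2_integrable|exact: integrable_cst].
have [_ E] := cintegral_linear c%:C (ci _ Lf) (ci _ Lg).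
move: f0 g0; rewrite /Defs.fhat !modeE => f0 g0.
have -> : (fun x => (c * f x + g x)%:C) = fun x => c%:C * (f x)%:C + (g x)%:C.
  by apply/funext => x; rewrite real_complexD real_complexM.
by rewrite E mulrDr mulrCA f0 g0 mulr0 addr0.
Qed.

End TorusL2.

Section WienerIncrements.
Local Open Scope complex_scope.
Context {R : realType} (a b : R) {d : measure_display} {Omega : measurableType d}
  (P : probability Omega R) (T : R) (F : R -> set (set Omega))
  (W : R -> (R -> R) -> Omega -> R) (e : nat -> R -> R).
Hypotheses (ab : a < b) (hF : filtration T F) (hW : cylindrical_wiener a b P T F W)
  (he : is_onb a b e).
Variables (s t : R).
Hypotheses (s0 : 0 <= s) (st : s < t) (tT : t <= T).
Local Notation dW h := (fun w => W t h w - W s h w).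

Let Le j : L20 a b (e j). Proof. by case: he. Qed.

Let inner_e i j : inner a b (e i) (e j) = (i == j)%:R. Proof. by case: he. Qed.

Let sF : 0 <= s <= T. Proof. by rewrite s0 (le_trans (ltW st)). Qed.

Let tF : 0 <= t <= T. Proof. by rewrite tT (le_trans s0 (ltW st)). Qed.

Let ts0 : 0 < t - s. Proof. by rewrite subr_gt0. Qed.

Lemma dW_measurable h : L20 a b h -> measurable_fun setT (dW h).
Proof.
move=> Lh; have mW r : 0 <= r <= T -> measurable_fun setT (W r h).
  move=> rT; apply: (@measurable_wrt_measurable _ _ _ (F r)).
    by have [] := hF.1 _ rT.
  exact: cw_adapted hW _ _ rT Lh.
by apply: measurable_funB; exact: mW.
Qed.

Lemma dW_linear (c : R) f g : L20 a b f -> L20 a b g ->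
  {ae P, forall w, dW (fun x => c * f x + g x) w = c * dW f w + dW g w}.
Proof.
move=> Lf Lg; have := cw_linear hW c tF Lf Lg; have := cw_linear hW c sF Lf Lg.
by apply: filterS2 => w -> ->; ring.
Qed.

Lemma dW_gaussian h : L20 a b h -> centered_gaussian P (dW h) ((t - s) * inner a b h h).
Proof. by move=> Lh; apply: (cw_gaussian hW) => //; exact: ltW. Qed.

Lemma dW_Lfun2 h : L20 a b h -> 0 < inner a b h h -> dW h \in Lfun P 2%:E.
Proof.
move=> Lh h0; apply: centered_gaussian_Lfun2 (dW_gaussian Lh); last exact: mulr_gt0.
exact: dW_measurable.
Qed.

Lemma dW_integral_sqr h : L20 a b h -> 0 < inner a b h h ->
  \int[P]_w (dW h w ^+ 2) = (t - s) * inner a b h h.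
Proof.
move=> Lh h0; rewrite /Rintegral (centered_gaussian_integral_sqr _ _ (dW_gaussian Lh))//.
  exact: dW_measurable.
exact: mulr_gt0.
Qed.

Let inner_e1 j : inner a b (e j) (e j) = 1. Proof. by rewrite inner_e eqxx. Qed.

Let inner_e_gt0 j : 0 < inner a b (e j) (e j). Proof. by rewrite inner_e1. Qed.

Lemma dW_onb_Lfun2 j : dW (e j) \in Lfun P 2%:E.
Proof. exact: dW_Lfun2. Qed.

Lemma dW_integral0 j : \int[P]_w dW (e j) w = 0.
Proof.
(* [h] is [- e j], written in the shape [c * f + g] on which [W] is known to be linear; its norm is
   again 1, so both increments have the same Gaussian law. *)
pose h x := (- 2) * e j x + e j x.
have Lh : L20 a b h by exact: L20_linear.
have h1 : inner a b h h = 1.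
  by rewrite inner_linear ?inner_e1; [ring|exact: (Le j).1..].
apply: (@centered_gaussian_integral0 _ _ _ P (dW (e j)) (dW h) (t - s)) => //.
- exact: dW_measurable.
- exact: dW_measurable.
- by rewrite -[t - s]mulr1 -(inner_e1 j); exact: dW_gaussian.
- by rewrite -[t - s]mulr1 -h1; exact: dW_gaussian.
- by apply: filterS (dW_linear (- 2) (Le j) (Le j)) => w ->; ring.
Qed.

(* Polarization: [dW (e i + e j)] has variance [2 (t - s)]. *)
Lemma dW_integralM i j : \int[P]_w (dW (e i) w * dW (e j) w) = (t - s) * (i == j)%:R.
Proof.
have [->|ij] := eqVneq i j.
  by rewrite -(inner_e1 j) -dW_integral_sqr.
pose h x := 1 * e i x + e j x.
have Lh : L20 a b h by exact: L20_linear.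
have h2 : inner a b h h = 2.
  rewrite inner_linear; [|exact: (Le _).1..]; rewrite !inner_e !eqxx (negbTE ij) mulr0n mulr1n.
  ring.
have h0 : 0 < inner a b h h by rewrite h2.
have i1 := Lfun2_integrable_sqr (dW_onb_Lfun2 i).
have i2 := Lfun2_integrableM (dW_onb_Lfun2 i) (dW_onb_Lfun2 j).
have i3 := Lfun2_integrable_sqr (dW_onb_Lfun2 j).
have i2' : P.-integrable setT (EFin \o (fun w => 2 * (dW (e i) w * dW (e j) w))).
  exact: (integrableZl measurableT 2 i2).
have := dW_integral_sqr Lh h0; rewrite h2.
have -> : \int[P]_w (dW h w ^+ 2) =
    \int[P]_w ((dW (e i) w ^+ 2 + 2 * (dW (e i) w * dW (e j) w)) + dW (e j) w ^+ 2).
  congr fine; apply: ae_eq_integral => //.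
  - by apply/measurable_EFinP/measurable_funX; exact: dW_measurable.
  - apply/measurable_EFinP; apply: measurable_funD; first apply: measurable_funD.
    + by apply: measurable_funX; exact: dW_measurable.
    + by apply: measurable_funM => //; apply: measurable_funM; exact: dW_measurable.
    + by apply: measurable_funX; exact: dW_measurable.
  - by apply: filterS (dW_linear 1 (Le i) (Le j)) => w -> _; congr EFin; ring.
rewrite (RintegralD measurableT (integrableD measurableT i1 i2') i3).
rewrite (RintegralD measurableT i1 i2') (RintegralZl _ measurableT i2).
rewrite !dW_integral_sqr// !inner_e1 mulr0 => E; lra.
Qed.

(** The martingale property of the noise: independence from the past factors the mean, and the
    increment is centered. *)
Lemma integral_adapted_dW Y j : measurable_wrt (F s) Y -> Y \in Lfun P 2%:E ->
  \int[P]_w (Y w * dW (e j) w) = 0.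
Proof.
move=> YF Y2; have Z2 := dW_onb_Lfun2 j.
rewrite (Rintegral_indepM (Lfun2_measurable Y2) (Lfun2_measurable Z2)
  (Lfun2_integrable Y2) (Lfun2_integrable Z2) (Lfun2_integrableM Y2 Z2)).
  by rewrite dW_integral0 mulr0.
by move=> A B mA mB; apply: (cw_indep hW s0 (ltW st) tT (Le j)) => //; exact: YF.
Qed.

End WienerIncrements.

(** * Evolution of the mean energy *)

Section EnergyEvolution.
Context {R : realType} (a b : R) (ab : a < b) {d : measure_display} {Omega : measurableType d}
  (P : probability Omega R).
Variables (T : R) (Nt : nat) (F : R -> set (set Omega)) (W : R -> (R -> R) -> Omega -> R)
  (e : nat -> R -> R) (N : nat) (G : (R -> R) -> R -> R) (s : nat) (A : 'M[R]_s)
  (bw : 'rV[R]_s) (u0 : R -> R) (U : nat -> Omega -> R -> R)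
  (V : nat -> 'I_s -> Omega -> R -> R) (dGW : nat -> Omega -> R -> R).
Hypotheses (T0 : 0 < T) (Nt0 : (0 < Nt)%N) (hF : filtration T F)
  (hW : cylindrical_wiener a b P T F W) (he : is_onb a b e)
  (GSN : forall f, SN a b N (G f))
  (sympl : forall i j, bw ord0 i * A i j + bw ord0 j * A j i = bw ord0 i * bw ord0 j)
  (bw1 : \sum_(i < s) bw ord0 i = 1)
  (hU : splitting_RK a b P T Nt F W e N G A bw u0 U V dGW).
Local Notation SN := (SN a b N).
Local Notation FN := (FN a b N).
Local Notation tau := (T / Nt%:R).
Local Notation time := (time T Nt).
Local Notation crd := (coord a b).
Local Notation wt := (coord_weight a b).

Lemma Hnorm2_coord f : SN f ->
  Hnorm2 a b 1 f = (\sum_(p : 'I_N * bool) wt p * crd p f ^+ 2)%:E.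
Proof.
by move=> Sf; rewrite (Hnorm2_SN ab Sf); congr (_%:E); apply: eq_bigr => p _; rewrite expr2.
Qed.

Let tau_gt0 : 0 < tau. Proof. by rewrite divr_gt0// ltr0n. Qed.

Let time_ge0 k : 0 <= time k.
Proof. by rewrite /Defs.time mulr_ge0// ltW. Qed.

Let timeS k : time k.+1 - time k = tau.
Proof. by rewrite /Defs.time -natr1 mulrDl mul1r addrC addKr. Qed.

Let time_lt k : time k < time k.+1.
Proof. by rewrite -subr_gt0 timeS. Qed.

Let time_le k : (k <= Nt)%N -> time k <= T.
Proof.
move=> kNt; rewrite /Defs.time mulrCA ler_piMr ?(ltW T0)//.
by rewrite ler_pdivrMr ?ltr0n// mul1r ler_nat.
Qed.

Let V_SN k i w : (k < Nt)%N -> SN (V k i w).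
Proof. by move=> kNt; have [SV _ _] := rk_stages hU w kNt; exact: SV. Qed.

Let FNV_trig k i w : is_trig a b (FN (V k i w)).
Proof. exact: (SN_is_trig ab (FN_SN ab N (V k i w))). Qed.

Let increment_SN k w : SN (fun x => tau * \sum_(i < s) bw ord0 i * FN (V k i w) x).
Proof. by apply: SNZ => //; apply: SN_sum => // i; apply: SNZ => //; exact: FN_SN. Qed.

Let dGW_SN k w : (k < Nt)%N -> SN (dGW k w).
Proof. by move=> kNt; have [] := rk_noise hU kNt. Qed.

Let U_step k w : (k < Nt)%N -> U k.+1 w =
  fun x => (U k w x + tau * \sum_(i < s) bw ord0 i * FN (V k i w) x) + dGW k w x.
Proof. by move=> kNt; apply/funext => x; exact: (rk_step hU). Qed.

Let U_SN k w : (k <= Nt)%N -> SN (U k w).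
Proof.
elim: k => [_|k IH kNt]; first by rewrite (rk_init hU); exact: PN_SN.
by rewrite U_step//; apply: SND => //; [apply: SND => //; exact: IH (ltnW kNt)|exact: dGW_SN].
Qed.

(** Coordinates of the Runge-Kutta substep, before the noise is added. *)
Let bar k (p : 'I_N * bool) w : R :=
  crd p (U k w) + tau * \sum_(i < s) bw ord0 i * crd p (FN (V k i w)).

Let coord_lin_FN (c : 'I_s -> R) k w (p : 'I_N * bool) :
  crd p (fun x => tau * \sum_(i < s) c i * FN (V k i w) x) =
  tau * \sum_(i < s) c i * crd p (FN (V k i w)).
Proof.
rewrite coordZ//; last by apply: is_trig_sum => // i; exact: is_trigZ.
rewrite coord_sum//; last by move=> i; exact: is_trigZ.
by congr (_ * _); apply: eq_bigr => i _; rewrite coordZ.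
Qed.

Let coord_step k w (p : 'I_N * bool) : (k < Nt)%N ->
  crd p (U k.+1 w) = bar k p w + crd p (dGW k w).
Proof.
move=> kNt; have tU := SN_is_trig ab (U_SN w (ltnW kNt)).
have tI := SN_is_trig ab (increment_SN k w).
have tX := SN_is_trig ab (dGW_SN w kNt).
by rewrite U_step// (coordD ab p (is_trigD tU tI) tX) (coordD ab p tU tI) coord_lin_FN.
Qed.

Let coord_stage k i w (p : 'I_N * bool) : (k < Nt)%N ->
  crd p (V k i w) = crd p (U k w) + tau * \sum_(j < s) A i j * crd p (FN (V k j w)).
Proof.
move=> kNt; have [_ st _] := rk_stages hU w kNt.
have -> : V k i w = fun x => U k w x + tau * \sum_(j < s) A i j * FN (V k j w) x.
  by apply/funext => x; exact: st.
have tI : is_trig a b (fun x => tau * \sum_(j < s) A i j * FN (V k j w) x).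
  by apply: is_trigZ => //; apply: is_trig_sum => // j; exact: is_trigZ.
by rewrite (coordD ab p (SN_is_trig ab (U_SN w (ltnW kNt))) tI) coord_lin_FN.
Qed.

Let energy_bar k w : (k < Nt)%N ->
  (\sum_(p : 'I_N * bool) wt p * bar k p w ^+ 2)%:E = Hnorm2 a b 1 (U k w).
Proof.
move=> kNt; rewrite Hnorm2_coord; last exact: U_SN (ltnW kNt).
congr (_%:E).
apply: (@symplectic_RK_quadratic _ ('I_N * bool)%type (fun p => wt p) _ A bw tau
  (fun p => crd p (U k w)) (fun i p => crd p (FN (V k i w)))
  (fun i p => crd p (V k i w)) sympl) => i.
- by move=> p; exact: coord_stage.
- exact: (FN_energy ab (V_SN i w kNt)).
Qed.

(** The stages are adapted by hypothesis, and the stage equation of a fixed [i0] gives the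
    coordinates of [U k] as a function of the stages alone. *)
Let bar_adapted k p : (k < Nt)%N -> measurable_wrt (F (time k)) (bar k p).
Proof.
move=> kNt.
have tT : 0 <= time k <= T by rewrite time_ge0 time_le// ltnW.
have [sF _] := hF.1 _ tT.
(* With no stage the weights would sum to 0 instead of 1. *)
have [i0] : exists i : 'I_s, true.
  case: (pickP (fun _ : 'I_s => true)) => [i _|none]; first by exists i.
  move: bw1; rewrite big_pred0; last by move=> i; exact: none.
  by move=> /esym/eqP; rewrite oner_eq0.
move=> _; apply/(measurable_wrtP _ sF).
have cV i l : @cmeasurable _ _ (g_sigma_algebraType (F (time k)))
    (fun w => fhat a b (V k i w) l).
  by have [? ?] := rk_measurable hU i kNt l; split; apply/(measurable_wrtP _ sF).
have cFN i l : @cmeasurable _ _ (g_sigma_algebraType (F (time k)))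
    (fun w => fhat a b (FN (V k i w)) l).
  by apply: cmeasurable_fhat_FN => // w; exact: V_SN.
have mcoord (Q : Omega -> R -> R) : (forall l, @cmeasurable _ _
      (g_sigma_algebraType (F (time k))) (fun w => fhat a b (Q w) l)) ->
    measurable_fun [set: g_sigma_algebraType (F (time k))] (fun w => crd p (Q w)).
  by move=> mQ; rewrite /coord; case: p.2; case: (mQ p.1.+1).
have mlin (c : 'I_s -> R) : measurable_fun [set: g_sigma_algebraType (F (time k))]
    (fun w => tau * \sum_(i < s) c i * crd p (FN (V k i w))).
  apply: measurable_funM => //; apply: measurable_sum => i.
  by apply: measurable_funM => //; exact: mcoord.
rewrite (_ : bar k p = fun w => (crd p (V k i0 w) -
    tau * \sum_(j < s) A i0 j * crd p (FN (V k j w))) +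
    tau * \sum_(i < s) bw ord0 i * crd p (FN (V k i w))); last first.
  by apply/funext => w; rewrite coord_stage// addrK.
apply: measurable_funD; last exact: mlin.
by apply: measurable_funB; [exact: mcoord|exact: mlin].
Qed.

(** All coordinate weights are at least 2, so the square of one coordinate is bounded by the energy
    of the substep, which equals that of [U k]. *)
Let bar_Lfun2 k p : (k < Nt)%N -> (\int[P]_w Hnorm2 a b 1 (U k w) < +oo)%E ->
  bar k p \in Lfun P 2%:E.
Proof.
move=> kNt Uoo.
have tT : 0 <= time k <= T by rewrite time_ge0 time_le// ltnW.
have mbar q : measurable_fun setT (bar k q).
  by apply: measurable_wrt_measurable (bar_adapted q kNt); have [] := hF.1 _ tT.
apply/Lfun2P; split => //; apply: le_lt_trans Uoo.
apply: ge0_le_integral => //.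
- by move=> w _; rewrite lee_fin sqr_ge0.
- by apply/measurable_EFinP; exact: measurable_funX.
- rewrite -(funext (fun w => energy_bar w kNt)).
  apply/measurable_EFinP; apply: measurable_sum => q.
  by apply: measurable_funM => //; exact: measurable_funX.
- move=> w _; rewrite -energy_bar// lee_fin (bigD1 p)//=.
  apply: ler_wpDr.
    by apply: sumr_ge0 => q _; rewrite mulr_ge0 ?sqr_ge0 ?coord_weight_ge0.
  rewrite ler_peMl ?sqr_ge0// coord_weightE.
  by have := sqr_ge0 ((p.1.+1 : int)%:~R * freq a b); lra.
Qed.

Let noise_residual k n w : (k < Nt)%N ->
  Hnorm2 a b 1 (fun x => dGW k w x - \sum_(j < n) (W (time k.+1) (e j) w - W (time k) (e j) w) * G (e j) x) =
  (\sum_(p : 'I_N * bool) wt p * (crd p (dGW k w) -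
    \sum_(j < n) (W (time k.+1) (e j) w - W (time k) (e j) w) * crd p (G (e j))) ^+ 2)%:E.
Proof.
move=> kNt.
have tG j : is_trig a b (G (e j)) := SN_is_trig ab (GSN (e j)).
have SX := dGW_SN w kNt.
pose S x := \sum_(j < n) (W (time k.+1) (e j) w - W (time k) (e j) w) * G (e j) x.
have SS : SN S by apply: SN_sum => // j; exact: SNZ.
rewrite (_ : (fun x => _) = fun x => dGW k w x + -1 * S x); last first.
  by apply/funext => x; rewrite mulN1r.
rewrite Hnorm2_coord; last by apply: SND => //; exact: SNZ.
congr (_%:E); apply: eq_bigr => p _; congr (_ * _ ^+ 2).
have tS := SN_is_trig ab SS.
rewrite (coordD ab p (SN_is_trig ab SX) (is_trigZ (-1) tS)) (coordZ ab p (-1) tS) mulN1r.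
rewrite (coord_sum ab); last by move=> j; exact: is_trigZ.
by congr (_ - _); apply: eq_bigr => j _; rewrite (coordZ ab).
Qed.

(** Finiteness appears on both sides of the implication: it makes the substep square integrable
    here, and has to be handed on to the next step. *)
Lemma energy_step k : (k < Nt)%N -> (\int[P]_w Hnorm2 a b 1 (U k w) < +oo)%E ->
  (\int[P]_w Hnorm2 a b 1 (U k.+1 w) =
    \int[P]_w Hnorm2 a b 1 (U k w) + tau%:E * hs_norm2 a b e 1 G)%E /\
  (\int[P]_w Hnorm2 a b 1 (U k.+1 w) < +oo)%E.
Proof.
move=> kNt Uoo.
pose X (p : 'I_N * bool) w := crd p (dGW k w).
pose Z j w := W (time k.+1) (e j) w - W (time k) (e j) w.
pose g j (p : 'I_N * bool) := crd p (G (e j)).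
have tT1 : time k.+1 <= T by exact: time_le.
have tk := time_lt k; have t0 := time_ge0 k.
have w0 (p : 'I_N * bool) : 0 <= wt p by exact: coord_weight_ge0.
have Y2 p : bar k p \in Lfun P 2%:E by exact: bar_Lfun2.
have Z2 j : Z j \in Lfun P 2%:E by exact: (dW_onb_Lfun2 hF hW he t0 tk tT1).
have YZ p j : \int[P]_w (bar k p w * Z j w) = 0.
  by apply: (integral_adapted_dW hF hW he t0 tk tT1) => //; exact: bar_adapted.
have ZZ i j : \int[P]_w (Z i w * Z j w) = tau * (i == j)%:R.
  by rewrite -(timeS k); exact: (dW_integralM hF hW he t0 tk tT1).
have mX p : measurable_fun setT (X p).
  have [_ mG _] := rk_noise hU kNt; have [mr mi] := mG p.1.+1.
  by rewrite /X /coord; case: p.2; apply: (@measurable_wrt_measurable _ _ _ measurable).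
have XZ : (fun n => \int[P]_w (\sum_p wt p * (X p w - \sum_(j < n) Z j w * g j p) ^+ 2)%:E)%E
    @ \oo --> 0%E.
  rewrite (_ : (fun n => _) = fun n => (\int[P]_w Hnorm2 a b 1 (fun x => dGW k w x -
      \sum_(j < n) (W (time k.+1) (e j) w - W (time k) (e j) w) * G (e j) x)%R)%E).
    by have [] := rk_noise hU kNt.
  by apply/funext => n; apply: eq_integral => w _; rewrite noise_residual.
have -> : (\int[P]_w Hnorm2 a b 1 (U k.+1 w) =
    \int[P]_w (\sum_p wt p * (bar k p w + X p w) ^+ 2)%:E)%E.
  apply: eq_integral => w _; rewrite Hnorm2_coord; last exact: U_SN.
  by congr (_%:E); apply: eq_bigr => p _; rewrite coord_step.
split.
  rewrite (integral_additive_noise w0 (ltW tau_gt0) Y2 Z2 YZ ZZ mX XZ); congr (_ + _ * _)%E.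
    by apply: eq_integral => w _; rewrite energy_bar.
  by apply: eq_eseriesr => j _; rewrite Hnorm2_coord.
exact: (integral_additive_noise_lty w0 Y2 Z2 YZ ZZ mX XZ).
Qed.

Lemma energy_evolution k : (k <= Nt)%N ->
  (\int[P]_w Hnorm2 a b 1 (U k w) =
   \int[P]_w Hnorm2 a b 1 (U 0%N w) + (time k)%:E * hs_norm2 a b e 1 G)%E /\
  (\int[P]_w Hnorm2 a b 1 (U k w) < +oo)%E.
Proof.
have E0 : (\int[P]_w Hnorm2 a b 1 (U 0 w) < +oo)%E.
  have U0E w : Hnorm2 a b 1 (U 0 w) =
      (\sum_(p : 'I_N * bool) wt p * crd p (PN a b N u0) ^+ 2)%:E.
    by rewrite (rk_init hU) Hnorm2_coord//; exact: PN_SN.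
  under eq_integral do rewrite U0E.
  (* The initial value does not depend on the sample, so its mean energy is a finite constant. *)
  by rewrite integral_cst//= [X in (_ * X)%E]probability_setT mule1 ltry.
move: energy_step E0; move: (fun j => \int[P]_w Hnorm2 a b 1 (U j w))%E => En.
move: (hs_norm2 _ _ _ _ _) => c step E0; elim: k => [_|k IH kNt].
  by split => //; rewrite /Defs.time mul0r mul0e adde0.
have [IHE IHoo] := IH (ltnW kNt); have [E Eoo] := step k kNt IHoo; split => //.
have -> : time k.+1 = time k + tau by rewrite -(timeS k) addrC subrK.
(* The squared Hilbert-Schmidt norm is an extended real here; distributivity holds because both time
   factors are nonnegative. *)
by rewrite E IHE EFinD ge0_muleDl ?lee_fin ?time_ge0 ?(ltW tau_gt0)// addeA.
Qed.

End EnergyEvolution.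

Unset Implicit Arguments.
Set Strict Implicit.
Set Printing Implicit Defensive.

Theorem proposition3p1 (R : realType) (a b : R) (hab : a < b)
    (d : measure_display) (Omega : measurableType d) (P : probability Omega R)
    (T : R) (hT : 0 < T) (Nt : nat) (hNt : (0 < Nt)%N)
    (F : R -> set (set Omega)) (hF : filtration T F)
    (W : R -> (R -> R) -> Omega -> R) (hW : cylindrical_wiener a b P T F W)
    (e : nat -> R -> R) (he : is_onb a b e)
    (sigma : R) (hsigma : 5 / 2 < sigma)
    (u0 : R -> R) (hu0 : H0 a b sigma u0)
    (Phi : (R -> R) -> R -> R) (hPhi : hilbert_schmidt a b e (sigma - 2) Phi)
    (N : nat) (hN : (1 <= N)%N)
    (G : (R -> R) -> R -> R) (hG : G = fun f => PN a b N (Lam a b (Phi f)))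
    (s : nat) (A : 'M[R]_s) (hA : A \in unitmx) (bw : 'rV[R]_s)
    (hsympl : forall i j : 'I_s,
       bw ord0 i * A i j + bw ord0 j * A j i = bw ord0 i * bw ord0 j)
    (hsum : \sum_(i < s) bw ord0 i = 1)
    (U : nat -> Omega -> R -> R) (V : nat -> 'I_s -> Omega -> R -> R)
    (dGW : nat -> Omega -> R -> R)
    (hU : splitting_RK a b P T Nt F W e N G A bw u0 U V dGW) :
  forall k : nat, (k <= Nt)%N ->
    (\int[P]_w Hnorm2 a b 1%R (U k w)
     = \int[P]_w Hnorm2 a b 1%R (U 0%N w)
       + (time T Nt k)%:E * hs_norm2 a b e 1%R G)%E.
Proof.
move=> k kNt; suff [] : (\int[P]_w Hnorm2 a b 1 (U k w) =
    \int[P]_w Hnorm2 a b 1 (U 0%N w) + (time T Nt k)%:E * hs_norm2 a b e 1 G)%E /\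
    (\int[P]_w Hnorm2 a b 1 (U k w) < +oo)%E by [].
apply: (energy_evolution hab hT hNt hF hW he _ hsympl hsum hU kNt).
by move=> f; rewrite hG; exact: PN_SN.
Qed.
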